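(* No-self-APSD enumeration on graphs with edge weights in $\{0,\dots,n^c\}$, for some constant $c$, can be solved with delay in $O(\overline{\Delta}+\log n)$, preprocessing in $O(n)$, and with space complexity in $\Theta(n)$.
   Context: Input: a directed or undirected graph $G=(V,E)$, $V=\{1,\dots,n\}$, with weights $w:E\to\{0,\dots,n^c\}$ ($c$ constant). $\overline{\Delta}$ is the average (out-)degree. $d(u,v)$ is the shortest weighted distance ($\infty$ if unreachable). No-self-APSD enumeration: output each triple $(u,v,d(u,v))$ with $u\neq v$ exactly once. Preprocessing: time allowed before the enumeration starts; delay in $O(f)$: time to first output after preprocessing, between consecutive outputs, and to signal termination are each $O(f)$. Model: word RAM with word size $\Omega(\log n)$, read-only adjacency lists with constant-time access to $n$ and vertex degrees. *)

(* Defs.v *)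
From mathcomp Require Import all_boot all_order all_algebra.

Set Implicit Arguments.
Unset Strict Implicit.
Unset Printing Implicit Defensive.

(* Only arcs matter for adjacency lists and distances: an undirected graph is
   the case where [edge] and [weight] are symmetric, every edge {u, v} then
   occurring in the lists of both u and v, and the average out-degree being
   the average degree 2|E|/n.  [weight] is meaningful on arcs only.  Vertex
   number i + 1 of V = {1, ..., n} is represented by i : 'I_n. *)
Record wgraph (n : nat) := WGraph {
  edge : rel 'I_n;
  weight : 'I_n -> 'I_n -> nat
}.

Section Graph.
Variables (n : nat) (G : wgraph n).

Definition weights_le (b : nat) : Prop :=
  forall u v : 'I_n, edge G u v -> weight G u v <= b.

Definition outdeg (u : 'I_n) : nat := #|[pred v | edge G u v]|.

Definition avg_outdeg : rat := ((\sum_(u < n) outdeg u)%N%:R / n%:R)%R.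

Definition walk (u v : 'I_n) (p : seq 'I_n) : bool :=
  path (edge G) u p && (last u p == v).

Fixpoint walk_weight (u : 'I_n) (p : seq 'I_n) : nat :=
  if p is v :: p' then weight G u v + walk_weight v p' else 0.

(* [None] stands for an infinite distance. *)
Definition is_dist (u v : 'I_n) (d : option nat) : Prop :=
  if d is Some k then
    (exists2 p, walk u v p & walk_weight u p = k) /\
    (forall p, walk u v p -> k <= walk_weight u p)
  else forall p, ~~ walk u v p.

Definition triple : Type := (nat * nat * option nat)%type.

Definition no_self_APSD (outs : seq triple) : Prop :=
  uniq outs /\
  forall x : triple, x \in outs <->
    exists u v : 'I_n, exists d : option nat,
      [/\ u != v, is_dist u v d & x = (u.+1, v.+1, d)].

End Graph.

(* The bit length of n, floor (log_2 n) + 1, which is Theta(log n) for n >= 2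
   and keeps bounds of the form C * log n meaningful (nonzero) at n = 1. *)
Definition log2 (n : nat) : nat := (trunc_log 2 n).+1.

(* Word RAM with words of w bits, i.e. the numbers 0, ..., 2^w - 1.  A program
   is a finite text, hence uses finitely many registers; the working memory is
   addressed by words, and the input is a separate read-only memory.  Every
   instruction takes unit time. *)

Inductive binop := Add | Sub | Mul | Div | And | Or | Xor | Shl | Shr.

(* [Sub] wraps around; division by zero yields 0. *)
Definition eval_binop (w : nat) (o : binop) (x y : nat) : nat :=
  (match o with
   | Add => x + y
   | Sub => x + 2 ^ w - y
   | Mul => x * y
   | Div => x %/ y
   | And => Nat.land x y
   | Or => Nat.lor x y
   | Xor => Nat.lxor x y
   | Shl => x * 2 ^ y
   | Shr => x %/ 2 ^ y
   end) %% 2 ^ w.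

Inductive instr :=
| Const (r k : nat)               (* reg r := k *)
| Move (r r1 : nat)               (* reg r := reg r1 *)
| Op (o : binop) (r r1 r2 : nat)  (* reg r := reg r1 o reg r2 *)
| MemRead (r a : nat)             (* reg r := wmem (reg a) *)
| MemWrite (a r : nat)            (* wmem (reg a) := reg r *)
| InpRead (r a : nat)             (* reg r := input (reg a) *)
| Jump (l : nat)
| JumpEq (r1 r2 l : nat)
| JumpLt (r1 r2 l : nat)
| Emit (ru rv rd : nat)           (* output (reg ru, reg rv, reg rd) *)
| EmitInf (ru rv : nat)           (* output (reg ru, reg rv, infinity) *)
| Halt.

Definition program := seq instr.

Record config := Config {
  pc : nat;
  reg : nat -> nat;
  wmem : nat -> nat
}.

Section Machine.
Variables (w : nat) (inp : nat -> nat) (P : program).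

Definition fetch (s : config) : instr := nth Halt P (pc s).

Definition halted (s : config) : bool := if fetch s is Halt then true else false.

Definition set_reg (s : config) (r x : nat) : config :=
  Config (pc s).+1 [eta reg s with r |-> x] (wmem s).

Definition goto (s : config) (l : nat) : config := Config l (reg s) (wmem s).

Definition step (s : config) : config :=
  match fetch s with
  | Const r k => set_reg s r (k %% 2 ^ w)
  | Move r r1 => set_reg s r (reg s r1)
  | Op o r r1 r2 => set_reg s r (eval_binop w o (reg s r1) (reg s r2))
  | MemRead r a => set_reg s r (wmem s (reg s a))
  | MemWrite a r => Config (pc s).+1 (reg s) [eta wmem s with reg s a |-> reg s r]
  | InpRead r a => set_reg s r (inp (reg s a))
  | Jump l => goto s l
  | JumpEq r1 r2 l => goto s (if reg s r1 == reg s r2 then l else (pc s).+1)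
  | JumpLt r1 r2 l => goto s (if reg s r1 < reg s r2 then l else (pc s).+1)
  | Emit _ _ _ | EmitInf _ _ => goto s (pc s).+1
  | Halt => s
  end.

Definition emitted (s : config) : option triple :=
  match fetch s with
  | Emit ru rv rd => Some (reg s ru, reg s rv, Some (reg s rd))
  | EmitInf ru rv => Some (reg s ru, reg s rv, None)
  | _ => None
  end.

(* Number of working-memory words needed for the cell accessed by the next
   instruction to exist. *)
Definition cells (s : config) : nat :=
  match fetch s with
  | MemRead _ a | MemWrite a _ => (reg s a).+1
  | _ => 0
  end.

Definition init : config := Config 0 (fun=> 0) (fun=> 0).

Definition run (t : nat) : config := iter t step init.

(* The first T instructions are ordinary ones and the next one is [Halt]. *)
Definition halts_after (T : nat) : Prop :=
  halted (run T) /\ forall t, t < T -> ~~ halted (run t).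

Definition outputs (T : nat) : seq triple :=
  pmap (fun t => emitted (run t)) (iota 0 T).

(* The instruction executed in configuration [run t] completes at time t + 1;
   the last event is the execution of [Halt], which signals termination. *)
Definition event_times (T : nat) : seq nat :=
  rcons [seq t.+1 | t <- iota 0 T & isSome (emitted (run t))] T.+1.

(* The working memory is charged up to the largest address ever accessed; the
   constantly many registers and the read-only input are not charged. *)
Definition space_used (T : nat) : nat := \max_(t < T) cells (run t).

(* The enumeration starts at time p: there is no output before p, and the
   waiting times from p to the first event and between consecutive events are
   at most D. *)
Definition delay_le (T p : nat) (D : rat) : Prop :=
  path (fun t t' => (t <= t')%N && ((t' - t)%N%:R <= D)%R) p (event_times T).

End Machine.

(* Linked list starting at address a of the read-only memory: three consecutive
   words hold a vertex number, a weight and the address of the next node; the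
   null address is 0. *)
Fixpoint list_at (w : nat) (inp : nat -> nat) (a : nat) (s : seq (nat * nat))
    : Prop :=
  if s is (v, x) :: s' then
    [/\ 0 < a, a.+2 < 2 ^ w, inp a = v, inp a.+1 = x &
        list_at w inp (inp a.+2) s']
  else a = 0.

(* Word 0 holds n; for vertex number i, word 2i - 1 holds its out-degree and
   word 2i the address of its adjacency list, whose order is arbitrary. *)
Definition encodes (w : nat) (inp : nat -> nat) (n : nat) (G : wgraph n)
    : Prop :=
  [/\ forall a, inp a < 2 ^ w,
      inp 0 = n,
      forall u : 'I_n, inp (u.*2.+1) = outdeg G u &
      forall u : 'I_n, exists2 s : seq (nat * nat),
        perm_eq s [seq ((val v).+1, weight G u v) | v <- enum 'I_n & edge G u v] &
        list_at w inp (inp u.*2.+2) s].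

(* Main.v *)
(* From a source s, Dijkstra's algorithm runs with a one-level radix heap: with
   "last" the current lower bound, a vertex of tentative distance x lies in
   bucket b for the least b such that x / 2^b = last / 2^b.  There are
   M + 2 = O(log n) buckets, since distances are below 2^M = INF, the value
   standing for infinity, and a vertex only ever moves to lower buckets.
   The buckets are consecutive intervals of one array of all vertices, so
   moving a vertex down by one bucket is a swap with the first vertex of its
   bucket.  One source thus costs O(m + n log n) steps of constant time.

   The results for source s are emitted, one every B = O(m / n + log n) steps,
   while the distances from source s + 1 are computed.  During the run from the
   first source, what is emitted instead is, for each vertex u of out-degree at
   most twice the average, the pair (u, v) with v the nearest out-neighbour of
   u, whose distance is the weight of the arc; these pairs are remembered and
   skipped later.  The first vertex gets no such pair, so that at least n / 4
   outputs are available during each run, even for n = 2.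

   The whole computation is one loop whose body is a loop-free command that
   makes one step of Dijkstra's algorithm and one step of the emission. *)
Require Import Defs.
From mathcomp Require Import all_boot all_order all_algebra.
From mathcomp Require Import zify.

Set Implicit Arguments.
Unset Strict Implicit.
Unset Printing Implicit Defensive.

(** * A loop-free command language and its compilation *)

(** The obstacle is the first run. Rows are emitted while the next one is computed, so nothing is
    ready at that time; yet O(n) preprocessing cannot afford a run, and the delay forbids a silent
    one. A pair leaving a vertex of small out-degree costs only a scan of one adjacency list, and
    Markov's inequality makes about half of the vertices eligible. As each vertex supplies at most
    one such pair, a later row loses at most one output, and one word per vertex suffices to
    remember it.

    One iteration of the loop is accounted for twice: it lowers a potential of the current run, and
    it raises the waiting time since the last output. [cinv] keeps the sum of both below B times the
    number of outputs in stock. The potential is about n (5 M + 3 m / n), at least n / 4 outputs are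
    in stock, and this ratio fixes B.

    All the mathematics takes place on [dstep] and [estep], functions on records over unbounded
    naturals. The commands only have to follow these functions without overflow, and a single
    simulation lemma carries the result to machine code. *)

Record state := State { rg : nat -> nat; fd : nat -> nat -> nat; out : seq triple }.

Inductive operand := Rg (r : nat) | Im (k : nat).

Inductive cmd :=
| CSkip
| CSeq (c1 c2 : cmd)
| CSet (r : nat) (x : operand)
| COp (o : binop) (r : nat) (x y : operand)
| CGet (r k : nat) (x : operand)
| CPut (k : nat) (x y : operand)
| CInp (r : nat) (x : operand)
| CSwap (k1 k2 : nat)
| CEmit (x y z : operand)
| CEmitInf (x y : operand)
| CIfEq (x y : operand) (c1 c2 : cmd)
| CIfLt (x y : operand) (c1 c2 : cmd).

(** Register and array numbers in programs are literals: comparing them with [Nat.eqb] lets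
    [wp_compute] decide every lookup by evaluation. Array indices are symbolic and are compared with
    [==]. *)
Definition setr (f : nat -> nat) (i x : nat) : nat -> nat :=
  fun j => if Nat.eqb j i then x else f j.
Definition seta (f : nat -> nat) (i x : nat) : nat -> nat :=
  fun j => if j == i then x else f j.
Definition setf (f : nat -> nat -> nat) (k i x : nat) : nat -> nat -> nat :=
  fun k' => if Nat.eqb k' k then seta (f k) i x else f k'.
Definition swapf (f : nat -> nat -> nat) (k1 k2 : nat) : nat -> nat -> nat :=
  fun k => if Nat.eqb k k1 then f k2 else if Nat.eqb k k2 then f k1 else f k.

Definition opval (s : state) (x : operand) : nat :=
  match x with Rg r => rg s r | Im k => k end.

Definition natop (o : binop) (x y : nat) : nat :=
  match o with
  | Add => x + y | Defs.Sub => x - y | Mul => x * y | Div => x %/ y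
  | Shl => x * 2 ^ y | Shr => x %/ 2 ^ y
  | And | Or | Xor => 0
  end.

Definition natop_ok (o : binop) (x y : nat) : bool :=
  match o with Defs.Sub => y <= x | And | Or | Xor => false | _ => true end.

Section Language.
Variables (w N : nat) (inp : nat -> nat).

(* Weakest precondition over unbounded naturals: the side conditions exclude
   overflow in words of w bits, underflow, and array indices above N. *)
Fixpoint wp (c : cmd) (Q : state -> Prop) (s : state) : Prop :=
  match c with
  | CSkip => Q s
  | CSeq c1 c2 => wp c1 (wp c2 Q) s
  | CSet r x => Q (State (setr (rg s) r (opval s x)) (fd s) (out s))
  | COp o r x y =>
      natop_ok o (opval s x) (opval s y) /\
      (natop o (opval s x) (opval s y) < 2 ^ w /\
       Q (State (setr (rg s) r (natop o (opval s x) (opval s y))) (fd s) (out s)))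
  | CGet r k x =>
      opval s x <= N /\
      Q (State (setr (rg s) r (fd s k (opval s x))) (fd s) (out s))
  | CPut k x y =>
      opval s x <= N /\
      Q (State (rg s) (setf (fd s) k (opval s x) (opval s y)) (out s))
  | CInp r x => Q (State (setr (rg s) r (inp (opval s x))) (fd s) (out s))
  | CSwap k1 k2 => Q (State (rg s) (swapf (fd s) k1 k2) (out s))
  | CEmit x y z =>
      Q (State (rg s) (fd s)
           (rcons (out s) (opval s x, opval s y, Some (opval s z))))
  | CEmitInf x y =>
      Q (State (rg s) (fd s) (rcons (out s) (opval s x, opval s y, None)))
  | CIfEq x y c1 c2 =>
      (opval s x = opval s y -> wp c1 Q s) /\ (opval s x <> opval s y -> wp c2 Q s)
  | CIfLt x y c1 c2 =>
      (opval s x < opval s y -> wp c1 Q s) /\ (opval s y <= opval s x -> wp c2 Q s)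
  end.

Lemma wp_mono c (Q Q' : state -> Prop) s :
  (forall s, Q s -> Q' s) -> wp c Q s -> wp c Q' s.
Proof.
elim: c Q Q' s => [|c1 IH1 c2 IH2|r x|o r x y|r k x|k x y|r x|k1 k2|x y z|x y|
  x y c1 IH1 c2 IH2|x y c1 IH1 c2 IH2] Q Q' s QQ' /=; try by [exact: QQ'].
- by apply: IH1 => s'; apply: IH2.
- by move=> [? [? /QQ' ?]].
- by move=> [? /QQ' ?].
- by move=> [? /QQ' ?].
- by move=> [H1 H2]; split=> [/H1|/H2]; [apply: IH1 | apply: IH2].
- by move=> [H1 H2]; split=> [/H1|/H2]; [apply: IH1 | apply: IH2].
Qed.

(* Machine registers 0 to 7 hold the offsets of the eight arrays and 8 to 10
   are scratch. *)
Definition ureg (r : nat) : nat := r + 11.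

Definition load (t : nat) (x : operand) : instr :=
  match x with Rg r => Move t (ureg r) | Im k => Const t k end.

Definition addr_code (k : nat) (x : operand) : seq instr :=
  [:: load 8 x; Const 9 8; Op Mul 8 8 9; Op Add 8 8 k].

(** Jumps are absolute, hence the start address [l]. In a conditional the code of [c2] comes first
    and is reached by falling through the comparison. *)
Fixpoint compile (c : cmd) (l : nat) : seq instr :=
  match c with
  | CSkip => [::]
  | CSeq c1 c2 => let s1 := compile c1 l in s1 ++ compile c2 (l + size s1)
  | CSet r x => [:: load (ureg r) x]
  | COp o r x y => [:: load 8 x; load 9 y; Op o (ureg r) 8 9]
  | CGet r k x => rcons (addr_code k x) (MemRead (ureg r) 8)
  | CPut k x y => addr_code k x ++ [:: load 9 y; MemWrite 8 9]
  | CInp r x => [:: load 8 x; InpRead (ureg r) 8]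
  | CSwap k1 k2 => [:: Move 8 k1; Move k1 k2; Move k2 8]
  | CEmit x y z => [:: load 8 x; load 9 y; load 10 z; Emit 8 9 10]
  | CEmitInf x y => [:: load 8 x; load 9 y; EmitInf 8 9]
  | CIfEq x y c1 c2 =>
      let s2 := compile c2 (l + 3) in
      let s1 := compile c1 (l + 4 + size s2) in
      [:: load 8 x; load 9 y; JumpEq 8 9 (l + 4 + size s2)] ++ s2 ++
      Jump (l + 4 + size s2 + size s1) :: s1
  | CIfLt x y c1 c2 =>
      let s2 := compile c2 (l + 3) in
      let s1 := compile c1 (l + 4 + size s2) in
      [:: load 8 x; load 9 y; JumpLt 8 9 (l + 4 + size s2)] ++ s2 ++
      Jump (l + 4 + size s2 + size s1) :: s1
  end.

Definition okop (x : operand) : bool := if x is Im k then k < 2 ^ w else true.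

Fixpoint static_ok (c : cmd) : bool :=
  match c with
  | CSkip => true
  | CSeq c1 c2 => static_ok c1 && static_ok c2
  | CSet r x => okop x
  | COp o r x y => okop x && okop y
  | CGet r k x => (k < 8) && okop x
  | CPut k x y => [&& k < 8, okop x & okop y]
  | CInp r x => okop x
  | CSwap k1 k2 => [&& k1 < 8, k2 < 8 & k1 != k2]
  | CEmit x y z => [&& okop x, okop y & okop z]
  | CEmitInf x y => okop x && okop y
  | CIfEq x y c1 c2 | CIfLt x y c1 c2 =>
      [&& okop x, okop y, static_ok c1 & static_ok c2]
  end.

(** * Correctness of the compiled code *)

Variable P : program.
Local Notation step := (step w inp P).

(* t instructions lead from m to m', access cells below S only, do not halt,
   and output o. *)
Definition exec (S t : nat) (m m' : config) (o : seq triple) : Prop :=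
  [/\ m' = iter t step m,
      forall j, j < t -> ~~ halted P (iter j step m),
      forall j, j < t -> cells P (iter j step m) <= S &
      o = pmap (fun j => emitted P (iter j step m)) (iota 0 t)].

Lemma exec0 S m : exec S 0 m m [::].
Proof. by split. Qed.

Lemma exec_cat S t1 t2 m1 m2 m3 o1 o2 :
  exec S t1 m1 m2 o1 -> exec S t2 m2 m3 o2 -> exec S (t1 + t2) m1 m3 (o1 ++ o2).
Proof.
move=> [E1 h1 c1 ->] [E2 h2 c2 ->].
have shift j : t1 <= j -> iter j step m1 = iter (j - t1) step m2.
  by move=> le; rewrite E1 -iterD subnK.
split.
- by rewrite E2 E1 -iterD addnC.
- move=> j lt; case: (ltnP j t1) => [|le]; first exact: h1.
  by rewrite shift //; apply: h2; lia.
- move=> j lt; case: (ltnP j t1) => [|le]; first exact: c1.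
  by rewrite shift //; apply: c2; lia.
- rewrite iotaD pmap_cat; congr (_ ++ _).
  rewrite add0n -[t1 in RHS]addn0 iotaDl; elim: (iota 0 t2) => //= j s IH.
  by rewrite shift ?leq_addr // addKn; case: emitted; rewrite IH.
Qed.

Lemma exec_step S m :
  ~~ halted P m -> cells P m <= S ->
  exec S 1 m (step m) (if emitted P m is Some x then [:: x] else [::]).
Proof.
by move=> h c; split=> [||j|] //; [move=> [|j] | case: j => [|j]].
Qed.

Definition codeat (l : nat) (s : seq instr) : Prop :=
  forall j, j < size s -> nth Halt P (l + j) = nth Halt s j.

Lemma codeat_cat l s1 s2 :
  codeat l (s1 ++ s2) -> codeat l s1 /\ codeat (l + size s1) s2.
Proof.
move=> H; split=> j lt.
  by rewrite H ?nth_cat ?lt // size_cat; lia.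
rewrite -addnA H ?size_cat ?nth_cat; last by lia.
by rewrite ltnNge leq_addr addKn.
Qed.

Lemma codeat_cons l i s :
  codeat l (i :: s) -> nth Halt P l = i /\ codeat l.+1 s.
Proof.
move=> H; split; first by have := H 0; rewrite addn0; apply.
by move=> j lt; rewrite addSnnS H.
Qed.

(* The eight arrays are interleaved with stride 8; [sg] is the current
   assignment of offsets, so that two arrays are exchanged in constant time. *)
Definition simst (s : state) (m : config) : Prop :=
  (forall r, reg m (ureg r) = rg s r) /\
  exists sg : nat -> nat,
    [/\ forall k, k < 8 -> reg m k = sg k,
        forall k, k < 8 -> sg k < 8,
        forall k k', k < 8 -> k' < 8 -> sg k = sg k' -> k = k' &
        forall k i, k < 8 -> wmem m (8 * i + sg k) = fd s k i].

Definition plain (i : instr) : bool :=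
  match i with
  | Const _ _ | Move _ _ | Op _ _ _ _ | InpRead _ _ => true
  | _ => false
  end.

Lemma exec_plain S m i :
  nth Halt P (pc m) = i -> plain i -> exec S 1 m (step m) [::].
Proof.
move=> E pl; have := @exec_step S m.
by rewrite /halted /cells /emitted /fetch E; case: (i) pl => //= [r k|r r1|o r r1 r2|r a] _ /(_ isT isT).
Qed.

Lemma simst_tmp s m t z :
  7 < t < 11 -> simst s m -> simst s (set_reg m t z).
Proof.
move=> t_b [Hr [sg [s1 s2 s3 s4]]]; split=> [r|] /=.
  by case: eqP => [|_]; [rewrite /ureg; lia | exact: Hr].
exists sg; split=> // k lt; case: eqP => [|_]; [lia | exact: s1].
Qed.

Lemma simst_reg s m r z :
  simst s m ->
  simst (State (setr (rg s) r z) (fd s) (out s)) (set_reg m (ureg r) z).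
Proof.
move=> [Hr [sg [s1 s2 s3 s4]]]; split=> [r'|] /=.
  rewrite /setr /ureg; have <- : (r' == r) = Nat.eqb r' r by [].
  by rewrite eqn_add2r -Hr.
exists sg; split=> // k lt; rewrite /ureg; case: eqP => [|_]; [lia | exact: s1].
Qed.

Lemma exec_load S s m t x :
  nth Halt P (pc m) = load t x -> okop x -> simst s m ->
  exec S 1 m (set_reg m t (opval s x)) [::].
Proof.
move=> E ok [Hr _]; have pl : plain (load t x) by case: x {E ok}.
have -> : set_reg m t (opval s x) = step m; last exact: exec_plain E pl.
rewrite /step /fetch E; case: x ok {E pl} => [r|k] /= ok; first by rewrite Hr.
by rewrite modn_small.
Qed.

Lemma exec_set S m i t z :
  nth Halt P (pc m) = i -> plain i -> step m = set_reg m t z ->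
  exec S 1 m (set_reg m t z) [::].
Proof. by move=> E pl <-; apply: exec_plain E pl. Qed.

Hypothesis fits : 8 * N + 8 < 2 ^ w.

Lemma exec_addr s m k x l :
  k < 8 -> okop x -> opval s x <= N -> simst s m -> pc m = l ->
  codeat l (addr_code k x) ->
  exists m', [/\ exec (8 * N + 8) 4 m m' [::], simst s m', pc m' = l + 4,
     wmem m' = wmem m & exists sg : nat -> nat,
    [/\ forall k, k < 8 -> sg k < 8,
        forall k k', k < 8 -> k' < 8 -> sg k = sg k' -> k = k',
        forall k i, k < 8 -> wmem m (8 * i + sg k) = fd s k i,
        forall k, k < 8 -> reg m' k = sg k &
        reg m' 8 = 8 * opval s x + sg k]].
Proof.
move=> kb okx xN sim <- /codeat_cons [E1 /codeat_cons [E2 /codeat_cons [E3]]].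
move=> /codeat_cons [E4 _].
have e1 := exec_load (8 * N + 8) E1 okx sim.
set m1 := set_reg m 8 _ in e1.
have sim1 : simst s m1 by apply: simst_tmp.
have e2 : exec (8 * N + 8) 1 m1 (set_reg m1 9 8) [::].
  apply: (exec_set (m := m1) _ E2 isT).
  by rewrite /step /fetch E2 modn_small //; lia.
set m2 := set_reg m1 9 _ in e2.
have sim2 : simst s m2 by apply: simst_tmp.
have e3 : exec (8 * N + 8) 1 m2 (set_reg m2 8 (8 * opval s x)) [::].
  apply: (exec_set (m := m2) _ E3 isT).
  rewrite /step /fetch E3 /eval_binop [reg m2 8]/= [reg m2 9]/= modn_small 1?mulnC //; lia.
set m3 := set_reg m2 8 _ in e3.
have sim3 : simst s m3 by apply: simst_tmp.
have [_ [sg [s1 s2 s3 s4]]] := sim3.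
have sgk := s2 _ kb.
have e4 : exec (8 * N + 8) 1 m3 (set_reg m3 8 (8 * opval s x + sg k)) [::].
  apply: (exec_set (m := m3) _ E4 isT).
  rewrite /step /fetch E4 /eval_binop (s1 k) // [reg m3 8]/= modn_small //; lia.
exists (set_reg m3 8 (8 * opval s x + sg k)); split=> //.
- exact: exec_cat e1 (exec_cat e2 (exec_cat e3 e4)).
- exact: simst_tmp.
- by rewrite /= addn4.
- exists sg; split=> // k' lt; have := s1 _ lt => /=; case: (k' =P 8) => //; lia.
Qed.

Lemma fd_inj (sg : nat -> nat) k k' i i' :
  (forall k, k < 8 -> sg k < 8) ->
  (forall k k', k < 8 -> k' < 8 -> sg k = sg k' -> k = k') ->
  k < 8 -> k' < 8 ->
  (8 * i' + sg k' == 8 * i + sg k) = Nat.eqb k' k && (i' == i).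
Proof.
move=> s2 s3 kb kb'; have := s2 _ kb; have := s2 _ kb'.
have <- : (k' == k) = Nat.eqb k' k by [].
case: (k' =P k) => [-> _ _ | ne b b'] /=; first by lia.
by apply/eqP => E; apply: ne; apply: s3 => //; lia.
Qed.

(** Without loops no instruction is executed twice, so the size of the code bounds its running time;
    this is what makes an iteration take constant time. [simst] does not look at [out s], which is
    related to the emitted triples by [o]. *)
Lemma compile_sim c Q s m l :
  static_ok c -> wp c Q s -> simst s m -> pc m = l -> codeat l (compile c l) ->
  exists t s' m' o,
    [/\ exec (8 * N + 8) t m m' o, t <= size (compile c l), simst s' m',
        pc m' = l + size (compile c l) & Q s' /\ out s' = out s ++ o].
Proof.
elim: c Q s m l => [|c1 IH1 c2 IH2|r x|o r x y|r k x|k x y|r x|k1 k2|x y z|x y|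
  x y c1 IH1 c2 IH2|x y c1 IH1 c2 IH2] Q s m l.
- move=> _ Qs sim pcl _; exists 0, s, m, [::].
  by rewrite /= addn0 cats0; split=> //; apply: exec0.
- move=> /= /andP[ok1 ok2] W sim pcl /codeat_cat [cd1 cd2].
  have [t1 [s1 [m1 [o1 [e1 t1b sim1 pc1 [W1 O1]]]]]] := IH1 _ _ _ _ ok1 W sim pcl cd1.
  have [t2 [s2 [m2 [o2 [e2 t2b sim2 pc2 [W2 O2]]]]]] := IH2 _ _ _ _ ok2 W1 sim1 pc1 cd2.
  exists (t1 + t2), s2, m2, (o1 ++ o2); split=> //.
  + exact: exec_cat e1 e2.
  + by rewrite size_cat leq_add.
  + by rewrite pc2 size_cat addnA.
  + by rewrite O2 O1 catA.
- move=> /= ok W sim <- /codeat_cons [E1 _].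
  exists 1, (State (setr (rg s) r (opval s x)) (fd s) (out s)), (set_reg m (ureg r) (opval s x)), [::].
  rewrite cats0 /= addn1; split=> //; first exact: exec_load E1 ok sim.
  exact: simst_reg.
- move=> /= /andP[okx oky] [nok [lt W]] sim <-.
  move=> /codeat_cons [E1 /codeat_cons [E2 /codeat_cons [E3 _]]].
  have e1 := exec_load (8 * N + 8) E1 okx sim.
  set m1 := set_reg m 8 _ in e1.
  have sim1 : simst s m1 by apply: simst_tmp.
  have e2 := @exec_load (8 * N + 8) _ m1 _ _ E2 oky sim1.
  set m2 := set_reg m1 9 _ in e2.
  have sim2 : simst s m2 by apply: simst_tmp.
  have e3 : exec (8 * N + 8) 1 m2 (set_reg m2 (ureg r) (natop o (opval s x) (opval s y))) [::].
    apply: (exec_set (m := m2) _ E3 isT).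
    rewrite /step /fetch E3 /eval_binop [reg m2 8]/= [reg m2 9]/=; congr set_reg.
    case: (o) nok lt => //= nok lt; try by rewrite modn_small.
    by rewrite -addnBAC // modnDr modn_small.
  do 4 eexists; split; [exact: exec_cat e1 (exec_cat e2 e3)|by []|exact: (simst_reg _ _ sim2)| |].
    by rewrite /= addn3.
  by rewrite /= cats0; split; first exact: W.
- move=> /= /andP[kb okx] [xN W] sim pcl cd.
  have [cd1 /codeat_cons [E _]]: codeat l (addr_code k x) /\ codeat (l + 4) [:: MemRead (ureg r) 8].
    by apply: (@codeat_cat _ (addr_code k x)).
  have [m1 [e1 sim1 pc1 wm1 [sg [s2 s3 s4 s1 a1]]]] := exec_addr kb okx xN sim pcl cd1.
  rewrite -pc1 in E.
  have e2 : exec (8 * N + 8) 1 m1 (set_reg m1 (ureg r) (fd s k (opval s x))) [::].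
    have := @exec_step (8 * N + 8) m1.
    rewrite /halted /cells /emitted /step /fetch E => /(_ isT).
    rewrite a1 wm1 s4 //; apply; have := s2 _ kb; lia.
  do 4 eexists; split; [exact: exec_cat e1 e2|by []|exact: (simst_reg _ _ sim1)| |].
    by rewrite /= pc1 -addnS.
  by rewrite /= cats0; split; first exact: W.
- move=> /= /and3P[kb okx oky] [xN W] sim pcl cd.
  have [cd1 /codeat_cons [E1 /codeat_cons [E2 _]]]: codeat l (addr_code k x) /\ codeat (l + 4) [:: load 9 y; MemWrite 8 9].
    by apply: (@codeat_cat _ (addr_code k x)).
  have [m1 [e1 sim1 pc1 wm1 [sg [s2 s3 s4 s1 a1]]]] := exec_addr kb okx xN sim pcl cd1.
  rewrite -pc1 in E1 E2.
  have e2 := exec_load (8 * N + 8) E1 oky sim1.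
  set m2 := set_reg m1 9 _ in e2.
  have sim2 : simst s m2 by apply: simst_tmp.
  have e3 := @exec_step (8 * N + 8) m2.
  rewrite /halted /cells /emitted /step /fetch E2 {1}[reg m2 8]/= a1 in e3.
  have {}e3 := e3 isT; have skb := s2 _ kb; have {}e3 := e3 ltac:(lia).
  do 4 eexists; split; [exact: exec_cat e1 (exec_cat e2 e3)|by []| | |].
  + instantiate (1 := State (rg s) (setf (fd s) k (opval s x) (opval s y)) (out s)).
    split; first by case: sim2.
    exists sg; split=> //.
      by move=> k' kb'; have := s1 _ kb' => /=; case: (k' =P 9) => //; lia.
    move=> k' i kb' /=; rewrite a1 fd_inj // /setf /seta wm1 s4 //.
    have -> : Nat.eqb k' k = (k' == k) by [].
    by case: (k' =P k) => [->|] //=.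
  + by rewrite /= pc1 -addn2 -addnA.
  + by rewrite /= cats0; split; first exact: W.
- move=> /= ok W sim <- /codeat_cons [E1 /codeat_cons [E2 _]].
  have e1 := exec_load (8 * N + 8) E1 ok sim.
  set m1 := set_reg m 8 _ in e1.
  have sim1 : simst s m1 by apply: simst_tmp.
  have e2 : exec (8 * N + 8) 1 m1 (set_reg m1 (ureg r) (inp (opval s x))) [::].
    by apply: (exec_set (m := m1) _ E2 isT); rewrite /step /fetch E2.
  do 4 eexists; split; [exact: exec_cat e1 e2|by []|exact: (simst_reg _ _ sim1)| |].
    by rewrite /= addn2.
  by rewrite /= cats0; split; first exact: W.
- move=> /= /and3P[kb1 kb2 ne] W sim <-.
  move=> /codeat_cons [E1 /codeat_cons [E2 /codeat_cons [E3 _]]].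
  have [Hr [sg [s1 s2 s3 s4]]] := sim.
  have e1 : exec (8 * N + 8) 1 m (set_reg m 8 (sg k1)) [::].
    by apply: (exec_set (m := m) _ E1 isT); rewrite /step /fetch E1 s1.
  set m1 := set_reg m 8 _ in e1.
  have e2 : exec (8 * N + 8) 1 m1 (set_reg m1 k1 (sg k2)) [::].
    apply: (exec_set (m := m1) _ E2 isT); rewrite /step /fetch E2 /=; case: eqP; first by lia.
    by rewrite s1.
  set m2 := set_reg m1 k1 _ in e2.
  have e3 : exec (8 * N + 8) 1 m2 (set_reg m2 k2 (sg k1)) [::].
    apply: (exec_set (m := m2) _ E3 isT); rewrite /step /fetch E3 /=; case: eqP => //; lia.
  do 4 eexists; split; [exact: exec_cat e1 (exec_cat e2 e3)|by []| | |].
  + instantiate (1 := State (rg s) (swapf (fd s) k1 k2) (out s)).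
    split=> [r|] /=.
      have neq k : k < 11 -> (ureg r == k) = false by rewrite /ureg; lia.
      by rewrite !neq ?Hr //; lia.
    (* Exchanging two offset registers composes the assignment of offsets with a transposition. *)
    pose sw k := if k == k1 then k2 else if k == k2 then k1 else k.
    have swlt k : k < 8 -> sw k < 8 by rewrite /sw; do 2 case: eqP => // _.
    exists (sg \o sw); split=> /=.
    * move=> k kb; rewrite /sw.
      case: (k =P k2) => [->|_]; first by case: eqP => // E; rewrite E eqxx in ne.
      case: (k =P k1) => [_|_] //.
      by case: eqP => [|_]; [lia|exact: s1].
    * by move=> k /swlt /s2.
    * move=> k k' kb kb' /s3; rewrite !swlt // => /(_ isT isT); rewrite /sw.
      by case: (k =P k1); case: (k =P k2); case: (k' =P k1); case: (k' =P k2); lia.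
    * move=> k i kb; rewrite s4 ?swlt // /swapf /sw.
      have -> : Nat.eqb k k1 = (k == k1) by [].
      have -> : Nat.eqb k k2 = (k == k2) by [].
      by do 2 case: eqP => // _.
  + by rewrite /= addn3.
  + by rewrite /= cats0; split; first exact: W.
- move=> /= /and3P[okx oky okz] W sim <-.
  move=> /codeat_cons [E1 /codeat_cons [E2 /codeat_cons [E3 /codeat_cons [E4 _]]]].
  have e1 := exec_load (8 * N + 8) E1 okx sim.
  set m1 := set_reg m 8 _ in e1.
  have sim1 : simst s m1 by apply: simst_tmp.
  have e2 := @exec_load (8 * N + 8) _ m1 _ _ E2 oky sim1.
  set m2 := set_reg m1 9 _ in e2.
  have sim2 : simst s m2 by apply: simst_tmp.
  have e3 := @exec_load (8 * N + 8) _ m2 _ _ E3 okz sim2.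
  set m3 := set_reg m2 10 _ in e3.
  have sim3 : simst s m3 by apply: simst_tmp.
  have e4 := @exec_step (8 * N + 8) m3.
  rewrite /halted /cells /emitted /step /fetch E4 in e4.
  have {}e4 := e4 isT isT.
  do 4 eexists; split; [exact: exec_cat e1 (exec_cat e2 (exec_cat e3 e4))|by []| | |].
  + instantiate (1 := State (rg s) (fd s) (rcons (out s) (opval s x, opval s y, Some (opval s z)))).
    exact: sim3.
  + by rewrite /= addn4.
  + by rewrite /= cats1; split; first exact: W.
- move=> /= /andP[okx oky] W sim <-.
  move=> /codeat_cons [E1 /codeat_cons [E2 /codeat_cons [E4 _]]].
  have e1 := exec_load (8 * N + 8) E1 okx sim.
  set m1 := set_reg m 8 _ in e1.
  have sim1 : simst s m1 by apply: simst_tmp.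
  have e2 := @exec_load (8 * N + 8) _ m1 _ _ E2 oky sim1.
  set m2 := set_reg m1 9 _ in e2.
  have sim2 : simst s m2 by apply: simst_tmp.
  have e4 := @exec_step (8 * N + 8) m2.
  rewrite /halted /cells /emitted /step /fetch E4 in e4.
  have {}e4 := e4 isT isT.
  do 4 eexists; split; [exact: exec_cat e1 (exec_cat e2 e4)|by []| | |].
  + instantiate (1 := State (rg s) (fd s) (rcons (out s) (opval s x, opval s y, None))).
    exact: sim2.
  + by rewrite /= addn3.
  + by rewrite /= cats1; split; first exact: W.
- move=> /= /and4P[okx oky ok1 ok2] [W1 W2] sim <-.
  move=> /codeat_cons [E1 /codeat_cons [E2 /codeat_cons [E3 cd]]].
  set s2 := compile c2 _ in E3 cd *; set s1 := compile c1 _ in cd *.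
  have [cd2 /codeat_cons [E4 cd1]] := codeat_cat cd.
  have e1 := exec_load (8 * N + 8) E1 okx sim.
  set m1 := set_reg m 8 _ in e1.
  have sim1 : simst s m1 by apply: simst_tmp.
  have e2 := @exec_load (8 * N + 8) _ m1 _ _ E2 oky sim1.
  set m2 := set_reg m1 9 _ in e2.
  have sim2 : simst s m2 by apply: simst_tmp.
  have e3 := @exec_step (8 * N + 8) m2.
  rewrite /halted /cells /emitted /step /fetch E3 in e3.
  have {e3} := exec_cat e1 (exec_cat e2 (e3 isT isT)).
  rewrite [reg m2 8]/= [reg m2 9]/= => e3.
  case: (opval s x =P opval s y) W1 W2 e3 => [TH /(_ TH) W1 _ e3|TH _ /(_ ltac:(exact: TH)) W2 e3].
    have := IH1 _ _ (goto m2 (pc m + 4 + size s2)) _ ok1 W1 sim2 erefl.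
    have EL : ((pc m).+3 + size s2).+1 = pc m + 4 + size s2 by lia.
    rewrite EL in cd1.
    rewrite -/s1.
    move=> /(_ cd1) [t [s' [m' [o [e tb sim' pc' [Q' O']]]]]].
    do 4 eexists; split; [exact: exec_cat e3 e| |exact: sim'| |by split; [exact: Q'|exact: O']].
      by rewrite size_cat /=; lia.
    by rewrite pc' /= size_cat /=; lia.
  have := IH2 _ _ (goto m2 (pc m).+3) _ ok2 W2 sim2 erefl.
  rewrite /s2 addn3 in cd2 *; move=> /(_ cd2) [t [s' [m' [o [e tb sim' pc' [Q' O']]]]]].
  rewrite -addn3 -/s2 in pc' tb E4 *.
  have e5 := @exec_step (8 * N + 8) m'.
  rewrite /halted /cells /emitted /step /fetch pc' E4 in e5.
  do 4 eexists; split; [exact: exec_cat e3 (exec_cat e (e5 isT isT))| |exact: sim'| |].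
  + by rewrite size_cat /=; lia.
  + by rewrite /= size_cat /=; lia.
  + by rewrite /= cats0; split; [exact: Q'|exact: O'].
- move=> /= /and4P[okx oky ok1 ok2] [W1 W2] sim <-.
  move=> /codeat_cons [E1 /codeat_cons [E2 /codeat_cons [E3 cd]]].
  set s2 := compile c2 _ in E3 cd *; set s1 := compile c1 _ in cd *.
  have [cd2 /codeat_cons [E4 cd1]] := codeat_cat cd.
  have e1 := exec_load (8 * N + 8) E1 okx sim.
  set m1 := set_reg m 8 _ in e1.
  have sim1 : simst s m1 by apply: simst_tmp.
  have e2 := @exec_load (8 * N + 8) _ m1 _ _ E2 oky sim1.
  set m2 := set_reg m1 9 _ in e2.
  have sim2 : simst s m2 by apply: simst_tmp.
  have e3 := @exec_step (8 * N + 8) m2.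
  rewrite /halted /cells /emitted /step /fetch E3 in e3.
  have {e3} := exec_cat e1 (exec_cat e2 (e3 isT isT)).
  rewrite [reg m2 8]/= [reg m2 9]/= => e3.
  case: (ltnP (opval s x) (opval s y)) W1 W2 e3 => [TH /(_ isT) W1 _ e3|TH _ /(_ isT) W2 e3].
    have := IH1 _ _ (goto m2 (pc m + 4 + size s2)) _ ok1 W1 sim2 erefl.
    have EL : ((pc m).+3 + size s2).+1 = pc m + 4 + size s2 by lia.
    rewrite EL in cd1.
    rewrite -/s1.
    move=> /(_ cd1) [t [s' [m' [o [e tb sim' pc' [Q' O']]]]]].
    do 4 eexists; split; [exact: exec_cat e3 e| |exact: sim'| |by split; [exact: Q'|exact: O']].
      by rewrite size_cat /=; lia.
    by rewrite pc' /= size_cat /=; lia.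
  have := IH2 _ _ (goto m2 (pc m).+3) _ ok2 W2 sim2 erefl.
  rewrite /s2 addn3 in cd2 *; move=> /(_ cd2) [t [s' [m' [o [e tb sim' pc' [Q' O']]]]]].
  rewrite -addn3 -/s2 in pc' tb E4 *.
  have e5 := @exec_step (8 * N + 8) m'.
  rewrite /halted /cells /emitted /step /fetch pc' E4 in e5.
  do 4 eexists; split; [exact: exec_cat e3 (exec_cat e (e5 isT isT))| |exact: sim'| |].
  + by rewrite size_cat /=; lia.
  + by rewrite /= size_cat /=; lia.
  + by rewrite /= cats0; split; [exact: Q'|exact: O'].
Qed.
End Language.

(** * Timing of a compiled loop *)

(* The third instruction touches cell n, for the lower bound on the space. *)
Definition prologue : seq instr :=
  [:: Const 8 0; InpRead 8 8; MemRead 9 8] ++ [seq Const k k | k <- iota 0 8].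

(** The prologue fills addresses 0 to 10, the test of the phase register 11 and 12, and the body
    starts at 13. Phase 10 leaves the loop. *)
Definition loop_prog (body : cmd) : program :=
  let code := compile body 13 in
  prologue ++ [:: Const 8 10; JumpEq (ureg 0) 8 (14 + size code)] ++ code ++
  [:: Jump 11; Halt].

Definition state0 : state := State (fun=> 0) (fun _ _ => 0) [::].

Definition gap (D : nat) : rel nat := fun t t' => (t <= t') && (t' - t <= D).

Section Loop.
Variables (w N n : nat) (inp : nat -> nat) (body : cmd).
Hypotheses (fits : 8 * N + 8 < 2 ^ w) (w_ge4 : 16 <= 2 ^ w).
Hypotheses (inp0 : inp 0 = n) (nN : n <= N) (body_ok : static_ok w body).

Local Notation P := (loop_prog body).
Local Notation S := (8 * N + 8).
Local Notation exec := (exec w inp P).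
Local Notation run := (run w inp P).
Local Notation step := (step w inp P).
Local Notation K := (size (compile body 13) + 3).

Lemma prog_at l s1 s2 s3 : P = s1 ++ s2 ++ s3 -> size s1 = l -> codeat P l s2.
Proof.
move=> -> <- j lt; rewrite nth_cat ltnNge leq_addr /= addKn nth_cat lt.
by [].
Qed.

Lemma prologue_at : codeat P 0 prologue.
Proof. exact: (@prog_at _ [::]). Qed.

Lemma head_at :
  codeat P 11 [:: Const 8 10; JumpEq (ureg 0) 8 (14 + size (compile body 13))].
Proof. exact: (@prog_at _ prologue). Qed.

Lemma body_at : codeat P 13 (compile body 13 ++ [:: Jump 11; Halt]).
Proof.
apply: (@prog_at _ (prologue ++ [:: Const 8 10;
  JumpEq (ureg 0) 8 (14 + size (compile body 13))]) _ [::]) => //.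
by rewrite cats0 /loop_prog -catA.
Qed.

Lemma exec_prologue :
  exists m, [/\ exec S 11 init m [::], simst state0 m, pc m = 11 &
                cells P (run 2) = n.+1].
Proof.
have := prologue_at; rewrite /prologue => /codeat_cat [cd1 cd2].
move: cd1 => /codeat_cons [E0 /codeat_cons [E1 /codeat_cons [E2 _]]].
pose m1 := set_reg init 8 0.
have e1 : exec S 1 init m1 [::].
  by apply: (exec_set (m := init) _ E0 isT); rewrite /Defs.step /fetch E0 mod0n.
pose m2 := set_reg m1 8 n.
have e2 : exec S 1 m1 m2 [::].
  by apply: (exec_set (m := m1) _ E1 isT); rewrite /Defs.step /fetch E1 /= inp0.
pose m3 := set_reg m2 9 0.
have e3 : exec S 1 m2 m3 [::].
  have := @exec_step w inp P S m2.
  rewrite /halted /cells /emitted /Defs.step /fetch E2.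
  by apply=> //=; lia.
have cl : cells P (run 2) = n.+1.
  have [-> _ _ _] : exec S 2 init (run 2) [::].
    by have [E _ _ _] := exec_cat e1 e2; have := exec_cat e1 e2; rewrite E.
  have [E _ _ _] := exec_cat e1 e2; rewrite -[iter _ _ _]E.
  by rewrite /cells /fetch E2.
have step_const k m : nth Halt P (pc m) = Const k k -> k < 8 ->
    exec S 1 m (set_reg m k k) [::].
  move=> E kb; apply: (exec_set (m := m) _ E isT).
  by rewrite /Defs.step /fetch E modn_small //; lia.
have consts k : k <= 8 -> exists m, [/\ exec S (3 + k) init m [::], pc m = 3 + k,
    forall r, reg m r = (if r < k then r else reg m3 r) & wmem m = wmem init].
  elim: k => [|k IH] kb.
    by exists m3; split=> //; have := exec_cat e1 (exec_cat e2 e3).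
  have [m [e pcm rm wm]] := IH (ltnW kb).
  have E : nth Halt P (pc m) = Const k k.
    by rewrite pcm cd2 ?size_map ?size_iota // (nth_map 0) ?size_iota // nth_iota.
  exists (set_reg m k k); split.
  - by have -> : 3 + k.+1 = 3 + k + 1 by [lia]; have := exec_cat e (step_const _ _ E kb).
  - by rewrite /= pcm addnS.
  - move=> r; rewrite [LHS]/= rm; case: (r =P k) => [->|ne].
      by rewrite ltnSn.
    by have -> : (r < k.+1) = (r < k) by lia.
  - by [].
have [m [e pcm rm wm]] := consts 8 isT.
exists m; split=> //; split=> [r|].
  rewrite rm /ureg ltnNge ltnW ?addn_gt0 /= -?addnBA //; last by lia.
  by have neq k : k < 11 -> (r + 11 == k) = false by [lia]; rewrite !neq.
by exists id; split=> // k lt; rewrite ?rm ?lt // wm.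
Qed.

Lemma exec_halt s m :
  simst s m -> pc m = 11 -> rg s 0 = 10 ->
  exists m', exec S 2 m m' [::] /\ halted P m'.
Proof.
move=> sim pc11 H0; have /codeat_cons [E0 /codeat_cons [E1 _]] := head_at.
rewrite -pc11 in E0.
have ok10 : okop w (Im 10) by rewrite /=; lia.
have e1 := exec_load (t := 8) (x := Im 10) inp S E0 ok10 sim.
set m1 := set_reg m 8 _ in e1.
have pc12 : pc m1 = 12 by rewrite /= pc11.
have [Hr _] := simst_tmp (opval s (Im 10)) (isT : 7 < 8 < 11) sim.
rewrite -/m1 in Hr.
have e2 := @exec_step w inp P S m1.
rewrite /halted /cells /emitted /Defs.step /fetch pc12 E1 Hr H0 eqxx in e2.
exists (goto m1 (14 + size (compile body 13))).
split; first exact: (exec_cat e1 (e2 isT isT)).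
have [_ /codeat_cons [_ /codeat_cons [E _]]] := codeat_cat body_at.
rewrite /halted /fetch [pc _]/=; have -> : 14 + size (compile body 13) = (13 + size (compile body 13)).+1 by [].
by rewrite E.
Qed.

Lemma exec_body Q s m :
  simst s m -> pc m = 11 -> rg s 0 <> 10 -> wp w N inp body Q s ->
  exists t s' m' o, [/\ exec S t m m' o, 0 < t <= K, simst s' m',
    pc m' = 11 & Q s' /\ out s' = out s ++ o].
Proof.
move=> sim pc11 H0 W; have /codeat_cons [E0 /codeat_cons [E1 _]] := head_at.
rewrite -pc11 in E0.
have ok10 : okop w (Im 10) by rewrite /=; lia.
have e1 := exec_load (t := 8) (x := Im 10) inp S E0 ok10 sim.
set m1 := set_reg m 8 _ in e1.
have pc12 : pc m1 = 12 by rewrite /= pc11.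
have sim1 : simst s m1 by apply: simst_tmp sim.
have [Hr _] := sim1.
have e2 := @exec_step w inp P S m1.
rewrite /halted /cells /emitted /Defs.step /fetch pc12 E1 Hr (introF eqP H0) in e2.
have {e1 e2} e2 := exec_cat e1 (e2 isT isT).
have [cd /codeat_cons [E _]] := codeat_cat body_at.
have pc13 : pc (goto m1 13) = 13 by [].
have [t [s' [m' [o [e tb sim' pc' [Q' O']]]]]] :=
  compile_sim fits body_ok W (sim1 : simst s (goto m1 13)) pc13 cd.
have e3 := @exec_step w inp P S m'.
rewrite /halted /cells /emitted /Defs.step /fetch pc' E in e3.
do 4 eexists; split.
- exact: (exec_cat e2 (exec_cat e (e3 isT isT))).
- lia.
- exact: sim'.
- by [].
- by rewrite /= cats0; split; [exact: Q' | exact: O'].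
Qed.

(** The events from time t on, so that an induction along the loop can remove one iteration at a
    time. *)
Definition events (t T : nat) : seq nat :=
  rcons [seq j.+1 | j <- iota t (T - t) & isSome (emitted P (run j))] T.+1.

Lemma events0 T : events 0 T = event_times w inp P T.
Proof. by rewrite /events subn0. Qed.

Lemma run_shift tau t m o o0 :
  exec S tau init m o0 -> exec S t m (iter t step m) o ->
  [seq j <- iota tau t | isSome (emitted P (run j))] =
  [seq tau + j | j <- iota 0 t & isSome (emitted P (iter j step m))].
Proof.
move=> [-> _ _ _] _; rewrite -[tau in LHS]addn0 iotaDl filter_map.
congr map; apply: eq_filter => j /=.
by rewrite /Defs.run addnC iterD.
Qed.

Lemma events_nil tau t m m' o0 T :
  exec S tau init m o0 -> exec S t m m' [::] -> tau + t <= T ->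
  events tau T = events (tau + t) T.
Proof.
move=> e0 e le; have [E _ _ O] := e; rewrite E in e.
rewrite /events; have -> : T - tau = t + (T - (tau + t)) by lia.
rewrite iotaD filter_cat map_cat (run_shift e0 e).
suff /size0nil -> : size [seq j <- iota 0 t | isSome (emitted P (iter j step m))] = 0 by [].
by rewrite size_filter -size_pmap -O.
Qed.

Lemma events_one tau t m m' o0 x :
  exec S tau init m o0 -> exec S t m m' [:: x] ->
  exists2 j, tau <= j < tau + t &
    forall T, tau + t <= T -> events tau T = j.+1 :: events (tau + t) T.
Proof.
move=> e0 e; have [E _ _ O] := e; rewrite E in e.
set s := [seq j <- iota 0 t | isSome (emitted P (iter j step m))].
have : size s = 1 by rewrite size_filter -size_pmap -O.
case Es : s => [|j []] // _; exists (tau + j).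
  have := mem_filter (fun j => isSome (emitted P (iter j step m))) j (iota 0 t).
  by rewrite -/s Es mem_head mem_iota => /esym /andP[_]; lia.
move=> T le; rewrite /events; have -> : T - tau = t + (T - (tau + t)) by lia.
by rewrite iotaD filter_cat map_cat (run_shift e0 e) -/s Es.
Qed.

(* [cnt] is the number of iterations since the last output. *)
Variables (cnt : state -> nat) (Bmax n2 : nat) (Inv : state -> Prop).
Hypothesis Inv_bound : forall s, Inv s -> cnt s <= Bmax /\ size (out s) <= n2.
Hypothesis Inv_step : forall s, Inv s -> rg s 0 <> 10 ->
  wp w N inp body (fun s' => Inv s' /\
    ((out s' = out s /\ cnt s' = (cnt s).+1) \/
     (exists x, out s' = rcons (out s) x /\ cnt s' = 0))) s.

(** [l] is the start or the time of the last event; the 1 in [cnt s + 1] pays for the rest of the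
    iteration that produced it. Each iteration lowers the measure: an output releases [Bmax + 2],
    more than the reset of [cnt] can cost. Termination thus follows from bounded waiting and a
    bounded number of outputs. *)
Lemma loop_run f s m tau l :
  (n2 - size (out s)) * (Bmax + 2) + (Bmax + 1 - cnt s) <= f ->
  Inv s -> simst s m -> pc m = 11 -> exec S tau init m (out s) ->
  l <= tau -> tau - l <= K * (cnt s + 1) ->
  exists T sf mf, [/\ tau <= T, Inv sf /\ rg sf 0 = 10, exec S T init mf (out sf),
     halted P mf & path (gap (K * (Bmax + 2))) l (events tau T)].
Proof.
elim: f s m tau l => [|f IH] s m tau l fb Is sim pcm ex lt gapl;
  have [cb ob] := Inv_bound Is; first by lia.
case: (rg s 0 =P 10) => [H0|H0].
  have [m' [e h]] := exec_halt sim pcm H0.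
  exists (tau + 2), s, m'; split=> //.
  - exact: leq_addr.
  - by have := exec_cat ex e; rewrite cats0.
  (* The phase test and [Halt] take 3 more time units, and 3 is at most [K]. *)
  - rewrite (events_nil ex e) // /events subnn /= /gap andbT; apply/andP; split; nia.
have [t [s' [m' [o [e tb sim' pc' [[Is' H] O']]]]]] :=
  exec_body sim pcm H0 (Inv_step Is H0).
have [cb' ob'] := Inv_bound Is'.
have ex' := exec_cat ex e; rewrite -O' in ex'.
case: H => [[Oe ce]|[x [Oe ce]]].
  have o0 : o = [::] by apply/size0nil; have := f_equal size Oe; rewrite O' size_cat; lia.
  have [] := IH s' m' (tau + t) l _ Is' sim' pc' ex'.
  - by rewrite Oe ce; nia.
  - lia.
  - by rewrite ce; nia.
  move=> T [sf [mf [Tb If exf hf pf]]]; exists T, sf, mf; split=> //; first by lia.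
  by rewrite o0 in e; rewrite (events_nil ex e).
have o1 : o = [:: x].
  by move: Oe; rewrite O' -cats1 => /eqP; rewrite eqseq_cat // eqxx => /eqP.
rewrite o1 in e.
have sz : size (out s') = (size (out s)).+1 by rewrite Oe size_rcons.
have [j jb ev] := events_one ex e.
have [] := IH s' m' (tau + t) j.+1 _ Is' sim' pc' ex'.
- by rewrite sz ce; nia.
- lia.
- by rewrite ce; nia.
move=> T [sf [mf [Tb If exf hf pf]]]; exists T, sf, mf; split=> //; first by lia.
by rewrite ev //= pf andbT /gap; apply/andP; split; nia.
Qed.

Variables (Pre : state -> Prop) (mu : state -> nat) (X : nat).
Hypothesis Pre_start : Pre state0 /\ mu state0 <= X.
Hypothesis Pre_step : forall s, Pre s -> rg s 0 <> 10 /\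
  wp w N inp body (fun s' => out s' = [::] /\
    ((Pre s' /\ mu s' < mu s) \/ Inv s')) s.

Lemma pre_run f s m tau :
  mu s <= f -> Pre s -> simst s m -> pc m = 11 -> out s = [::] ->
  exec S tau init m [::] ->
  exists p s' m', [/\ p <= tau + K * f.+1, Inv s', simst s' m', pc m' = 11 &
    out s' = [::] /\ exec S p init m' [::]].
Proof.
elim: f s m tau => [|f IH] s m tau fb Ps sim pcm os ex;
  have [H0 W] := Pre_step Ps;
  have [t [s' [m' [o [e tb sim' pc' [[O1 H] O']]]]]] := exec_body sim pcm H0 W;
  have o0 : o = [::] by move: O'; rewrite os O1 /= => <-.
- rewrite o0 in e; have ex' := exec_cat ex e.
  case: H => [[_ ?]|Is']; first by lia.
  by exists (tau + t), s', m'; split=> //; nia.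
- rewrite o0 in e; have ex' := exec_cat ex e.
  case: H => [[Ps' lt]|Is'].
    have [p [s2 [m2 [pb H2]]]] := IH s' m' (tau + t) ltac:(lia) Ps' sim' pc' O1 ex'.
    by move=> H3 H4 H5; exists p, s2, m2; split=> //; nia.
  by exists (tau + t), s', m'; split=> //; nia.
Qed.

Lemma loop_correct :
  exists T, [/\ halts_after w inp P T,
    exists sf, [/\ Inv sf, rg sf 0 = 10 & outputs w inp P T = out sf],
    exists2 p, p <= 11 + K * X.+1 &
      path (gap (K * (Bmax + 2))) p (event_times w inp P T) &
    n < space_used w inp P T <= 8 * N + 8].
Proof.
have [m [e sim pcm cl]] := exec_prologue.
have [P0 mu0] := Pre_start.
have [p [s [m' [pb Is sim' pc' [os ex]]]]] := pre_run mu0 P0 sim pcm erefl e.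
have [T [sf [mf [Tb [If H10] [E h c o] hf pf]]]] :=
  loop_run (leqnn _) Is sim' pc' (eq_ind_r (fun z => exec S p init m' z) ex os) (leqnn p)
    (leq_trans (eq_leq (subnn p)) (leq0n _)).
exists T; split.
- by split; [rewrite /Defs.run -E | exact: h].
- by exists sf; split.
- exists p; first exact: pb.
  by rewrite -events0 (events_nil (tau := 0) (exec0 _ _ _ _ _) ex).
- apply/andP; split; last by apply/bigmax_leqP => i _; apply: c.
  (* Time 2 is when cell n is read; the run is longer since no instruction of the prologue halts. *)
  have T2 : 2 < T.
    case: (ltnP 2 T) => // T2; have [_ h11 _ _] := e.
    by have := h11 T ltac:(lia); rewrite -E hf.
  by rewrite -cl; exact: (leq_bigmax (Ordinal T2)).
Qed.
End Loop.

(** * Radix-heap Dijkstra as a transition system *)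

Lemma setaE f i x j : seta f i x j = if j == i then x else f j.
Proof. by []. Qed.

Lemma sum_seta n (f : nat -> nat) v z :
  v < n -> \sum_(i < n) seta f v z i + f v = \sum_(i < n) f i + z.
Proof.
move=> lt; rewrite (bigD1 (Ordinal lt)) // [in RHS](bigD1 (Ordinal lt)) //= setaE eqxx.
rewrite (eq_bigr (fun i : 'I_n => f i)); first by lia.
by move=> i; rewrite -val_eqE setaE /=; case: eqP.
Qed.

Lemma divn_exp_half x b : 0 < b -> x %/ 2 ^ b = x %/ 2 ^ b.-1 %/ 2.
Proof. by case: b => // b _; rewrite expnSr divnMA. Qed.

Lemma divn_exp_le x y b c : b <= c -> x %/ 2 ^ b = y %/ 2 ^ b -> x %/ 2 ^ c = y %/ 2 ^ c.
Proof. by move=> /subnKC <- E; rewrite expnD !divnMA E. Qed.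

Record dstate := DState {
  dph : nat; dret : nat; di : nat; dsrc : nat; dh : nat; dlast : nat;
  dcv : nat; dj : nat; den : nat; da : nat;
  dD : nat -> nat; dperm : nat -> nat; dpos : nat -> nat; dbk : nat -> nat;
  dstart : nat -> nat }.

Section Dijkstra.
Variables (w : nat) (inp : nat -> nat) (n M wmax : nat) (adj : nat -> seq (nat * nat)).

Inductive reach (s : nat) : nat -> nat -> Prop :=
| reach0 : reach s s 0
| reachS x k y wt : reach s x k -> (y.+1, wt) \in adj x -> reach s y (k + wt).

Definition isD (s v : nat) (d : option nat) : Prop :=
  if d is Some k then reach s v k /\ (forall k', reach s v k' -> k <= k')
  else forall k, ~ reach s v k.

Local Notation INF := (2 ^ M).

Definition row_ok (s : nat) (D : nat -> nat) : Prop :=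
  forall v, v < n -> isD s v (if D v == INF then None else Some (D v)).

Hypothesis adj_list : forall v, v < n -> list_at w inp (inp (v * 2 + 2)) (adj v).
Hypothesis adj_bound : forall (v y wt : nat), v < n -> (y, wt) \in adj v ->
  (0 < y <= n) && (wt <= wmax).
Hypothesis short : forall u v k, u < n -> reach u v k -> exists2 k', reach u v k' & k' < INF.

(* When the first nonempty bucket is b > 0, [last] is raised to the least
   multiple of 2^(b-1) whose block contains the keys of that bucket, instead of
   to their minimum: this needs no search and moves all of them down. *)
Definition dstep (d : dstate) : dstate :=
  let 'DState ph ret i src h last cv j en a D perm pos bk st := d in
  match ph with
  | 3 => if i == n then DState 4 ret 0 src h last cv j en a D perm pos bk st
         else DState 3 ret (i + 1) src h last cv j en a (seta D i INF)
                (seta perm i i) (seta pos i i) (seta bk i (M + 1)) st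
  | 4 => if i == M + 2 then
           DState 6 5 i src 0 0 src j en a (seta D src 0) perm pos bk (seta st i n)
         else DState 4 ret (i + 1) src h last cv j en a D perm pos bk (seta st i 0)
  | 5 => if h == n then DState 9 ret i src h last cv j en a D perm pos bk st
         else let u := perm h in let b := bk u in
           if b == 0 then
             DState 8 ret i src (h + 1) last cv j en (inp (u * 2 + 2)) D perm pos bk st
           else DState 7 ret i src h (D u %/ 2 ^ (b - 1) * 2 ^ (b - 1)) cv h
                  (st (b + 1)) a D perm pos bk st
  | 6 => let b := bk cv in
         if b == 0 then DState ret ret i src h last cv j en a D perm pos bk st
         else if D cv %/ 2 ^ (b - 1) == last %/ 2 ^ (b - 1) then
           let i0 := st b in let y := perm i0 in let p := pos cv in
           DState 6 ret i src h last cv j en a D (seta (seta perm i0 cv) p y)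
             (seta (seta pos cv i0) y p) (seta bk cv (b - 1)) (seta st b (i0 + 1))
         else DState ret ret i src h last cv j en a D perm pos bk st
  | 7 => if j == en then DState 5 ret i src h last cv j en a D perm pos bk st
         else DState 6 7 i src h last (perm j) (j + 1) en a D perm pos bk st
  | 8 => if a == 0 then DState 5 ret i src h last cv j en a D perm pos bk st
         else let y := inp a - 1 in let nd := last + inp (a + 1) in
           if nd < D y then
             DState 6 8 i src h last y j en (inp (a + 2)) (seta D y nd) perm pos bk st
           else DState 8 ret i src h last cv j en (inp (a + 2)) D perm pos bk st
  | _ => d
  end.

(* [st b] is the number of vertices in buckets below b; settled vertices are
   those at positions below h and stay in bucket 0 forever. *)
Record buckets (h : nat) (perm pos bk st : nat -> nat) : Prop := Buckets {
  pos_perm : forall i, i < n -> perm i < n /\ pos (perm i) = i;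
  perm_pos : forall v, v < n -> pos v < n /\ perm (pos v) = v;
  bk_le : forall v, v < n -> bk v <= M + 1;
  st_le : forall b, b <= M + 2 -> st b <= n;
  st_bk : forall v b, v < n -> b <= M + 2 -> (bk v < b) = (pos v < st b);
  h_st : h <= st 1 }.

(** Bucket b occupies the positions from [st b] up to, but excluding, [st (b + 1)]. Once [v] stands
    at the first of them, raising [st b] by one hands exactly [v] over to bucket b - 1. The bounds
    on [i0] show that no position below h is touched. *)
Lemma buckets_move h perm pos bk st v :
  buckets h perm pos bk st -> v < n -> h <= pos v -> 0 < bk v ->
  let i0 := st (bk v) in let y := perm i0 in let p := pos v in
  [/\ buckets h (seta (seta perm i0 v) p y) (seta (seta pos v i0) y p)
        (seta bk v (bk v - 1)) (seta st (bk v) (i0 + 1)),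
      h <= i0 <= p, y < n, pos y = i0 & bk y = bk v].
Proof.
move=> [pP qP bl sl sb hs] vn hv bv i0 y p.
have [pn pv] := qP _ vn; rewrite -/p in pn pv hv.
have b1 := bl _ vn.
have i0p : i0 <= p.
  have := sb v (bk v) vn ltac:(lia); rewrite ltnn -/i0 -/p; lia.
have pst : p < st (bk v).+1.
  by rewrite -sb //; lia.
have [yn yi] : y < n /\ pos y = i0 by apply: pP; lia.
have byl : bk v <= bk y.
  by rewrite leqNgt sb //; [rewrite yi ltnn | lia].
have byu : bk y < (bk v).+1.
  by rewrite sb //; [rewrite yi; lia | lia].
have by_ : bk y = bk v by lia.
have hi0 : h <= i0.
  apply: leq_trans hs _; rewrite leqNgt -yi -sb //; lia.
(* [v] may already be the first vertex of its bucket, and then the swap changes nothing. *)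
have vy : v = y -> i0 = p by move=> E; rewrite -yi -E.
have yv : i0 = p -> v = y by move=> E; rewrite /y E pv.
have stm c : c <= bk v -> st c <= i0.
  by move=> le; rewrite leqNgt -yi -sb ?by_; lia.
have stM c : bk v < c -> c <= M + 2 -> p < st c.
  by move=> lt le; rewrite -sb.
split=> //; last by rewrite hi0.
have inj x x' : x < n -> x' < n -> pos x = pos x' -> x = x'.
  by move=> /qP [_ E] /qP [_ E'] e; rewrite -E -E' e.
split.
- move=> i lt; have [qn qq] := pP _ lt; rewrite !setaE.
  case: (i =P p) => [->|np].
    by rewrite eqxx.
  case: (i =P i0) => [->|ni].
    by rewrite eqxx; case: eqP => [/vy|]; split=> //; lia.
  case: (perm i =P y) => [E|_]; first by rewrite E yi in qq; lia.
  by case: (perm i =P v) => [E|_] //; rewrite E in qq; lia.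
- move=> x xn; have [qn qq] := qP _ xn; rewrite !setaE.
  case: (x =P y) => [->|ny].
    by rewrite eqxx.
  case: (x =P v) => [->|nv].
    by rewrite eqxx; case: eqP => [/yv|]; split=> //; lia.
  case: (pos x =P p) => [E|_]; first by case: nv; apply: inj.
  case: (pos x =P i0) => [E|_]; first by case: ny; apply: inj => //; rewrite yi.
  by [].
- by move=> x xn; rewrite setaE; have := bl _ xn; case: eqP => // _; lia.
- by move=> b bb; rewrite setaE; have := sl _ bb; case: eqP => // _; lia.
- move=> x c xn cb; rewrite !setaE; have sx := sb x c xn cb.
  case: (x =P v) => [xv|nv].
    have -> : (if x == y then p else i0) = i0.
      by case: eqP => // xy; rewrite vy // -xv.
    case: (c =P bk v) => [->|nc]; first by lia.
    case: (ltnP c (bk v)) => lc; first by have := stm c ltac:(lia); lia.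
    by have := stM c ltac:(lia) cb; lia.
  case: (x =P y) => [xy|ny].
    rewrite xy by_; case: (c =P bk v) => [->|nc]; first by have ne : i0 <> p by [move/yv => E; apply: nv; rewrite xy E]; rewrite ltnn; lia.
    by rewrite -/p -sb.
  case: (c =P bk v) => [cE|nc] //.
  rewrite sx cE -/i0; have : pos x <> i0 by rewrite -yi => /(inj _ _ xn yn).
  lia.
- by rewrite setaE; case: eqP => _; lia.
Qed.

(** The key already shares the block of half the length, 2^(bk v - 1), with [last], so that a lower
    bucket is due. *)
Definition movable (last : nat) (D bk : nat -> nat) (v : nat) : bool :=
  (0 < bk v) && (D v %/ 2 ^ (bk v - 1) == last %/ 2 ^ (bk v - 1)).

(* [rest] is the part of the adjacency list of the last settled vertex that is
   still to be relaxed, and [ex] the set of vertices that are allowed to lie in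
   too high a bucket. *)
Record base src h last (D perm pos bk st : nat -> nat)
    (rest : seq (nat * nat)) (ex : nat -> bool) : Prop := Base {
  b_buckets : buckets h perm pos bk st;
  b_h : h <= n;
  b_last : last <= INF;
  b_settled : forall v, v < n -> pos v < h -> D v <= last;
  b_open : forall v, v < n -> h <= pos v ->
     last <= D v /\ D v %/ 2 ^ bk v = last %/ 2 ^ bk v;
  b_strict : forall v, v < n -> h <= pos v -> ~~ ex v -> ~~ movable last D bk v;
  b_good : forall v, v < n -> D v <= INF /\ (D v = INF \/ reach src v (D v));
  b_src : D src = 0;
  b_relax : forall (x y wt : nat), x < n -> pos x < h -> (y, wt) \in adj x ->
     D y.-1 <= D x + wt \/ (D x = last /\ (y, wt) \in rest);
  b_rest : forall (y wt : nat), (y, wt) \in rest ->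
     (0 < y <= n) && (wt <= wmax) /\ (last = INF \/ reach src y.-1 (last + wt)) }.

Definition exempt (r j en : nat) (pos : nat -> nat) (v : nat) : bool :=
  (r == 7) && (j <= pos v < en).

Definition context r h last j en a (D pos bk : nat -> nat) (rest : seq (nat * nat)) : Prop :=
  match r with
  | 5 => rest = [::]
  | 7 => [/\ rest = [::], h <= j, j <= en, en <= n &
          forall v, v < n -> j <= pos v < en -> movable last D bk v]
  | 8 => list_at w inp a rest
  | _ => False
  end.

(* A bound on the number of remaining steps, every move to a lower bucket being
   worth 5.  That suffices because each vertex of a redistributed bucket moves
   down at least once, which pays for the visit of the vertex. *)
Definition pot_base h (pos bk : nat -> nat) (rest : seq (nat * nat)) : nat :=
  5 * (\sum_(v < n) bk v) + 3 * (n - h) +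
  3 * (\sum_(v < n | h <= pos v) size (adj v) + size rest).

(** Leaving phase 6 without a move releases 4, which pays for that step and for any value here.
    While vertices are pending, phase 7 needs only 1, because the vertex visited next is [movable]
    and phase 6 then starts at 0; hence 2 is enough in phase 5. *)
Definition pot_phase r j en : nat :=
  match r with 5 => 2 | 7 => if j < en then 1 else 3 | _ => 3 end.

Local Notation m := (\sum_(v < n) size (adj v)).
Definition pot_run : nat := 5 * (n * (M + 1)) + 3 * n + 3 * m + 4.
(** Phases 3 and 4 take n + 1 and M + 3 steps, including the changes of phase. *)
Definition pot_start : nat := n + (M + 4) + pot_run.

Definition fresh i (D perm pos bk : nat -> nat) : Prop :=
  forall v, v < i -> [/\ D v = INF, perm v = v, pos v = v & bk v = M + 1].

Definition dinv (d : dstate) (phi : nat) : Prop :=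
  let 'DState ph ret i src h last cv j en a D perm pos bk st := d in
  src < n /\
  match ph with
  | 3 => [/\ i <= n, fresh i D perm pos bk & n - i + (M + 4) + pot_run <= phi]
  | 4 => [/\ i <= M + 2, fresh n D perm pos bk, forall b, b < i -> st b = 0 &
             M + 2 - i + 1 + pot_run <= phi]
  | 5 | 7 | 8 => exists rest,
     [/\ base src h last D perm pos bk st rest (exempt ph j en pos),
         context ph h last j en a D pos bk rest &
         pot_base h pos bk rest + pot_phase ph j en <= phi]
  | 6 => exists rest,
     [/\ base src h last D perm pos bk st rest
           (fun v => (v == cv) || exempt ret j en pos v),
         context ret h last j en a D pos bk rest,
         [/\ cv < n, h <= pos cv & ret = 7 -> pos cv < j] &
         pot_base h pos bk rest + (if movable last D bk cv then 0 else 4) <= phi]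
  | 9 => row_ok src D
  | _ => False
  end.

(** * Preservation of the invariant by each phase of a run *)

Lemma pot_phase_le r j en : pot_phase r j en <= 3.
Proof. by case: r => [|[|[|[|[|[|[|[|r]]]]]]]] //=; case: ifP. Qed.

(** With all vertices settled and all arcs relaxed, induction along a walk bounds D v by its weight.
    A vertex left at INF is unreachable, since otherwise [short] would give a walk lighter than
    INF. *)
Lemma base_final src last D perm pos bk st ex :
  src < n -> base src n last D perm pos bk st [::] ex -> row_ok src D.
Proof.
move=> sn [bu _ _ _ _ _ go s0 rl _].
have lower v k : reach src v k -> v < n /\ D v <= k.
  elim=> [|x k' y wt _ [xn IH] yx]; first by rewrite s0.
  have /= yb := adj_bound xn yx; split; first by lia.
  have [|/=|[_ //]] := rl _ _ _ xn _ yx; last by lia.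
  by have [] := perm_pos bu xn.
move=> v vn; have [le [E|R]] := go _ vn.
  rewrite E eqxx => k R; have [k' R' lt] := short sn R.
  by have [_] := lower _ _ R'; rewrite E; lia.
case: eqP => [E|_] /=.
  by move=> k /(short sn) [k' /lower [_]]; rewrite E; lia.
by split=> // k' /lower [].
Qed.

Lemma base_ext src h last D perm pos bk st rest ex ex' :
  (forall v, v < n -> ~~ ex' v -> ~~ ex v || ~~ movable last D bk v) ->
  base src h last D perm pos bk st rest ex ->
  base src h last D perm pos bk st rest ex'.
Proof.
move=> H [b1 b2 b3 b4 b5 b6 b7 b8 b9 b10]; split=> // v vn hv /(H _ vn) /orP[|//].
exact: b6.
Qed.

Lemma list_atP a s : list_at w inp a s ->
  if a == 0 then s = [::] else
  exists s', [/\ s = (inp a, inp (a + 1)) :: s', list_at w inp (inp (a + 2)) s' &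
                 a + 2 < 2 ^ w].
Proof.
case: s => [|[v x] s] /=; first by move=> ->.
move=> [a0 lt <- <- L]; rewrite addn1 addn2; case: eqP a0 => [->//|_ _].
by exists s.
Qed.

Lemma dinv_init ret i src h last cv j en a D perm pos bk st phi :
  dinv (DState 3 ret i src h last cv j en a D perm pos bk st) phi ->
  0 < phi /\ dinv (dstep (DState 3 ret i src h last cv j en a D perm pos bk st)) phi.-1.
Proof.
move=> [sn [i_n fr le]]; rewrite /dstep.
case: eqP => [E|ne]; split; try by lia.
  by split=> //; split=> //; [rewrite -E | lia].
split=> //; split; [lia| |lia].
move=> v vi; rewrite !setaE; case: eqP => [->//|nv].
by apply: fr; lia.
Qed.

(** Bucket M + 1 is right for the key INF = 2^M while [last] is 0: the two agree after division by
    2^(M+1) but not after division by 2^M. Only the source, with key 0, lies too high, so phase 6 is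
    entered to bring it down. *)
Lemma dinv_start ret i src h last cv j en a D perm pos bk st phi :
  dinv (DState 4 ret i src h last cv j en a D perm pos bk st) phi ->
  0 < phi /\ dinv (dstep (DState 4 ret i src h last cv j en a D perm pos bk st)) phi.-1.
Proof.
move=> [sn [iM fr s0 le]]; rewrite /dstep.
case: eqP => [E|ne]; split; try by lia.
  split=> //; exists [::].
  have M0 : 0 < 2 ^ M by rewrite expn_gt0.
  have big v : v < n -> INF %/ 2 ^ bk v = 0.
    by move=> /fr [_ _ _ ->]; rewrite divn_small // ltn_exp2l; lia.
  split=> //.
  - split=> //.
    + split.
      * by move=> v /[dup] vn /fr [_ -> _ _]; have [_ _ -> _] := fr _ vn.
      * by move=> v /[dup] vn /fr [_ _ -> _]; have [_ -> _ _] := fr _ vn.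
      * by move=> v /fr [_ _ _ ->].
      * by move=> b bM; rewrite setaE; case: eqP => // nb; rewrite s0; lia.
      * move=> v b vn bM; have [_ _ -> ->] := fr _ vn.
        by rewrite setaE; case: eqP => [->|nb]; [lia | rewrite s0; lia].
      * by [].
    + move=> v vn _; rewrite setaE; case: eqP => // _.
      by have [-> _ _ _] := fr _ vn; rewrite big // div0n.
    + move=> v vn _; rewrite orbF => nv; rewrite /movable setaE (negbTE nv).
      have [-> _ _ ->] := fr _ vn; rewrite addn1 subn1 divnn expn_gt0 div0n.
      by rewrite andbF.
    + move=> v vn; rewrite setaE; case: eqP => [->|_].
        by split=> //; right; apply: reach0.
      by have [-> _ _ _] := fr _ vn; split=> //; left.
    + by rewrite setaE eqxx.
  - rewrite /pot_base; have -> : \sum_(v < n) bk v = n * (M + 1).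
      rewrite (eq_bigr (fun=> M + 1)) ?sum_nat_const ?card_ord // => v _.
      by have [_ _ _ ->] := fr v (ltn_ord v).
    have -> : \sum_(v < n | 0 <= pos v) size (adj v) = m by apply: eq_bigl.
    rewrite addn0; have := le; rewrite /pot_run.
    by case: ifP; lia.
split=> //; split=> //; try lia.
by move=> b bi; rewrite setaE; case: eqP => // nb; apply: s0; lia.
Qed.

(** Position h belongs to the first bucket b with an unsettled vertex. If b = 0, the key equals
    [last] and the vertex can be settled. Otherwise the keys of bucket b agree with [last] after
    division by 2^b and exceed it after division by 2^(b-1), so their quotients by 2^(b-1) all equal
    that of [last] plus one. Their common multiple of 2^(b-1) is therefore a valid new [last] and
    makes each of these vertices [movable]. *)
Lemma dinv_extract ret i src h last cv j en a D perm pos bk st phi :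
  dinv (DState 5 ret i src h last cv j en a D perm pos bk st) phi ->
  0 < phi /\ dinv (dstep (DState 5 ret i src h last cv j en a D perm pos bk st)) phi.-1.
Proof.
move=> [sn [rest [B /= r0 le]]]; subst rest; rewrite /dstep.
split; first by lia.
case: eqP => [E|hn].
  by split=> //; rewrite E in B; apply: base_final B.
have [bu hb lb se op sr go s0 rl re] := B.
have hlt : h < n by lia.
have [un up] := pos_perm bu hlt; set u := perm h in un up *.
have bkle := bk_le bu un.
have [lu qu] := op _ un ltac:(lia).
case: eqP => [b0|b0]; split=> //.
  have Du : D u = last by move: qu; rewrite b0 expn0 !divn1.
  (* Only [u] stands at position h, so settling it transfers exactly its list from the sum to
     [rest], at no change of potential. *)
  have sumE : \sum_(v < n | h <= pos v) size (adj v) =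
       size (adj u) + \sum_(v < n | h + 1 <= pos v) size (adj v).
    rewrite (bigD1 (Ordinal un)) /= ?up //; congr (_ + _); apply: eq_bigl => v.
    rewrite -val_eqE /= addn1 ltn_neqAle andbC; congr andb; apply/idP/idP.
      by apply: contra => /eqP E; rewrite /u E; have [_ ->] := perm_pos bu (ltn_ord v).
    by apply: contra => /eqP E; rewrite E up.
  have hst : h + 1 <= st 1 by rewrite addn1 -{1}up -(st_bk bu) ?b0 //; lia.
  exists (adj u); split.
  - split=> //.
    + by case: bu => *; split.
    + lia.
    + move=> v vn hv; case: (v =P u) => [->|nv]; first by rewrite Du.
      apply: se => //; suff : pos v <> h by lia.
      by move=> E; apply: nv; rewrite /u -E; have [_ ->] := perm_pos bu vn.
    + by move=> v vn hv; apply: op; lia.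
    + by move=> v vn hv _; apply: sr => //; lia.
    + move=> x y wt xn hx yx; case: (x =P u) => [E|nx].
        by right; rewrite E Du -E.
      left; have [|//|[_ //]] := rl _ _ _ xn _ yx.
      suff : pos x <> h by lia.
      by move=> E; apply: nx; rewrite /u -E; have [_ ->] := perm_pos bu xn.
    + move=> y wt yu; have yb := adj_bound un yu; split=> //.
      have [_ [E|R]] := go _ un; first by left; rewrite -Du.
      right; rewrite -Du; apply: reachS R _.
      by rewrite prednK //; lia.
  - by rewrite /=; apply: adj_list.
  - by move: le; rewrite /pot_base sumE /=; lia.
set b := bk u in b0 bkle qu *.
have b_gt0 : 0 < b by lia.
have sb1 := st_bk bu (v := u) (b := b) un ltac:(lia).
have sb2 := st_bk bu (v := u) (b := b + 1) un ltac:(lia).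
have nmu := sr _ un ltac:(lia) isT.
pose q x := x %/ 2 ^ (b - 1).
have qhalf x : x %/ 2 ^ b = q x %/ 2 by rewrite divn_exp_half // /q subn1.
have qmono x y : x <= y -> q x <= q y by apply: leq_div2r.
have E0 : 0 < 2 ^ (b - 1) by rewrite expn_gt0.
set last' := _ * _; have ql' : q last' = q (D u) by rewrite /q mulnK.
have strict v : v < n -> h <= pos v -> bk v = b -> q last < q (D v).
  move=> vn hv bv; have := sr _ vn hv isT; rewrite /movable bv b_gt0 /= => ne.
  have [lv _] := op _ vn hv; rewrite ltn_neqAle qmono // andbT.
  by apply: contra ne => /eqP; rewrite /q => ->.
have qeq v : v < n -> h <= pos v -> bk v = b -> q (D v) = q (D u).
  move=> vn hv bv; have := strict _ vn hv bv; have := strict _ un ltac:(lia) erefl.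
  have [_] := op _ vn hv; rewrite bv !qhalf; move: qu; rewrite !qhalf.
  by lia.
have lowb v : v < n -> h <= pos v -> b <= bk v.
  move=> vn hv; rewrite leqNgt (st_bk bu) //; last by lia.
  by move: sb1; rewrite ltnn up; lia.
have l'D : last' <= D u by apply: leq_trunc_div.
have ll' : last < last'.
  have := strict _ un ltac:(lia) erefl; rewrite -ql' => lt.
  by rewrite ltnNge; apply/negP => /qmono; lia.
have l'b : last' %/ 2 ^ b = last %/ 2 ^ b by rewrite qhalf ql' -qhalf.
have inr v : v < n -> h <= pos v < st (b + 1) -> bk v = b.
  move=> vn /andP[hv]; rewrite -(st_bk bu) //; last by lia.
  by have := lowb _ vn hv; lia.
exists [::]; split=> //.
- split=> //.
  + by have [Du _] := go _ un; apply: leq_trans l'D Du.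
  + by move=> v vn hv; apply: leq_trans (se _ vn hv) (ltnW ll').
  + move=> v vn hv; have [lv qv] := op _ vn hv; have lo := lowb _ vn hv.
    have qv' : D v %/ 2 ^ bk v = last' %/ 2 ^ bk v.
      by rewrite qv; apply: divn_exp_le (lo) _; rewrite l'b.
    split=> //; case: (b =P bk v) => [E|ne].
      apply: leq_trans (leq_trunc_div (D v) (2 ^ (b - 1))).
      by rewrite leq_mul2r -/(q (D v)) -/(q (D u)) (qeq v) // leqnn orbT.
    (* A key of a higher bucket below the new [last] would lie between the old and the new one,
       which share a block of length 2^(bk v - 1); the vertex would have been [movable] before. *)
    have nm := sr _ vn hv isT.
    rewrite leqNgt; apply/negP => lt; move: nm; rewrite /movable => /negP; apply.
    have bv1 : b <= bk v - 1 by clear -lo ne; lia.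
    apply/andP; split; first by clear -b_gt0 lo; lia.
    have lb' : last' %/ 2 ^ (bk v - 1) = last %/ 2 ^ (bk v - 1).
      exact: divn_exp_le l'b.
    rewrite eqn_leq (leq_div2r _ lv) andbT -lb'; apply: leq_div2r; exact: ltnW.
  + move=> v vn hv; rewrite /exempt /= hv -(st_bk bu) //; last by clear -bkle; lia.
    rewrite -leqNgt => lo; have := sr _ vn hv isT; rewrite /movable.
    suff -> : last' %/ 2 ^ (bk v - 1) = last %/ 2 ^ (bk v - 1) by [].
    by apply: divn_exp_le l'b; clear -lo; lia.
  + move=> x y wt xn hx yx; left; by have [|[_ //]] := rl _ _ _ xn hx yx.
- split=> //.
  + by clear -sb2 up; lia.
  + by apply: (st_le bu); clear -bkle; lia.
  + move=> v vn hv; have bv := inr _ vn hv; rewrite /movable bv b_gt0 /=.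
    by rewrite -/(q (D v)) -/(q last') ql' (qeq v) //; case/andP: hv.
- have lt : h < st (b + 1) by clear -sb2 up; lia.
  by rewrite [pot_phase _ _ _]/= lt; clear -le; lia.
Qed.

(** During a redistribution [cv] stands before position j, and so does its partner in the swap,
    which stands no later than [cv]. Hence the pending vertices, at positions j to en - 1, stay the
    same. *)
Lemma dinv_move ret i src h last cv j en a D perm pos bk st phi :
  dinv (DState 6 ret i src h last cv j en a D perm pos bk st) phi ->
  0 < phi /\ dinv (dstep (DState 6 ret i src h last cv j en a D perm pos bk st)) phi.-1.
Proof.
move=> [sn [rest [B C [cn hc cj] le]]].
have stop : ~~ movable last D bk cv ->
    0 < phi /\ dinv (DState ret ret i src h last cv j en a D perm pos bk st) phi.-1.
  move=> nm; rewrite (negbTE nm) in le; split; first by lia.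
  have B' : base src h last D perm pos bk st rest (exempt ret j en pos).
    by apply: base_ext B => v vn; case: (v =P cv) => [-> _|_ /= ->] //; rewrite nm orbT.
  have R : ret \in [:: 5; 7; 8].
    by case: (ret) C => [|[|[|[|[|[|[|[|[|]]]]]]]]].
  move: B' C le; move: R; rewrite !inE => /or3P[] /eqP -> B' C le; split=> //;
    exists rest; split=> //; have := pot_phase_le; [move/(_ 5)|move/(_ 7)|move/(_ 8)];
    move/(_ j en); lia.
rewrite /dstep; case: eqP => [b0|b0]; first by apply: stop; rewrite /movable b0.
case: ifP => [mv|mv]; last by apply: stop; rewrite /movable mv andbF.
have mov : movable last D bk cv by rewrite /movable mv lt0n; move/eqP: b0 => ->.
clear stop; rewrite mov in le.
have [bu hb lb se op sr go s0 rl re] := B.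
have bgt0 : 0 < bk cv by rewrite lt0n; apply/eqP.
have [bu' /andP[hi ip] yn yi by_] := buckets_move bu cn hc bgt0.
set i0 := st (bk cv) in bu' hi ip yi *; set y := perm i0 in bu' yn yi by_ *.
set p := pos cv in bu' hi ip hc *.
set perm' := seta (seta perm _ _) _ _ in bu' *.
set pos' := seta (seta pos _ _) _ _ in bu' *.
set bk' := seta bk _ _ in bu' *.
set st' := seta st _ _ in bu' *.
have pos'E v : v < n -> pos' v = (if v == y then p else if v == cv then i0 else pos v) by [].
have hpos v : v < n -> (h <= pos' v) = (h <= pos v).
  move=> vn; rewrite pos'E //; case: (v =P y) => [->|_]; first by rewrite yi; clear -hi ip; lia.
  by case: (v =P cv) => [->|_] //; rewrite -/p; clear -hi ip; lia.
have bkE v : v <> cv -> bk' v = bk v by rewrite /bk' setaE; case: eqP.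
have bkc : bk' cv = bk cv - 1 by rewrite /bk' setaE eqxx.
have rangeE v : ret = 7 -> v < n -> (j <= pos' v < en) = (j <= pos v < en).
  move=> /cj pj vn; rewrite pos'E //; case: (v =P y) => [->|_].
    by rewrite yi; clear -ip pj; rewrite -/p in pj; lia.
  by case: (v =P cv) => [->|_] //; clear -ip pj; rewrite -/p in pj *; lia.
have exE v : v < n -> exempt ret j en pos' v = exempt ret j en pos v.
  by move=> vn; rewrite /exempt; case: eqP => //= E; apply: rangeE.
have sumb : \sum_(v < n) bk' v + 1 = \sum_(v < n) bk v.
  by have := sum_seta bk (bk cv - 1) cn; rewrite -/bk'; clear -bgt0; lia.
have potE : pot_base h pos' bk' rest + 5 = pot_base h pos bk rest.
  rewrite /pot_base -sumb.
  have -> : \sum_(v < n | h <= pos' v) size (adj v) = \sum_(v < n | h <= pos v) size (adj v).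
    by apply: eq_bigl => v; apply: hpos.
  by clear; lia.
have phi2 : pot_base h pos' bk' rest + 5 <= phi by rewrite potE; clear -le; lia.
split; first by clear -phi2; lia.
split=> //; exists rest; split.
- split=> //.
  + by move=> v vn; rewrite ltnNge hpos // -ltnNge; apply: se.
  + move=> v vn; rewrite hpos // => /(op _ vn) [lv qv]; split=> //.
    by case: (v =P cv) => [->|/bkE -> //]; rewrite bkc; apply/eqP.
  + move=> v vn; rewrite hpos // exE // => hv ex; have := sr _ vn hv ex.
    by move: ex; rewrite negb_or /movable => /andP[/eqP /bkE -> _].
  + by move=> x z wt xn; rewrite ltnNge hpos // -ltnNge; apply: rl.
- have mv' v : v < n -> v <> cv -> movable last D bk' v = movable last D bk v.
    by move=> _ /bkE E; rewrite /movable E.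
  move: C rangeE {exE B}; case: (ret) cj => [|[|[|[|[|[|[|[|[|]]]]]]]]] //= cj [r0 hj je en_ mvs] rangeE.
  split=> // v vn; rewrite rangeE // => jv; rewrite mv' ?mvs //.
  by move=> E; move: jv (cj erefl); rewrite E; clear; lia.
- split=> //; first by rewrite hpos.
  move=> /cj pj; rewrite pos'E // eqxx; case: eqP => _; clear -pj ip; rewrite -/p in pj; lia.
- by case: ifP => _; clear -phi2; lia.
Qed.

Lemma dinv_redistribute ret i src h last cv j en a D perm pos bk st phi :
  dinv (DState 7 ret i src h last cv j en a D perm pos bk st) phi ->
  0 < phi /\ dinv (dstep (DState 7 ret i src h last cv j en a D perm pos bk st)) phi.-1.
Proof.
move=> [sn [rest [B [r0 hj je en_ mvs] le]]]; rewrite /dstep.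
rewrite /= in le; case: eqP => [E|ne].
  rewrite E ltnn in le; split; first by lia.
  split=> //; exists rest; split=> //; last by rewrite /=; lia.
  apply: (base_ext _ B) => v vn _; rewrite /exempt E /=.
  by apply/orP; left; apply/negP; lia.
have jn : j < n by lia.
have [cn cp] := pos_perm (b_buckets B) jn.
have jlt : j < en by lia.
rewrite jlt in le; split; first by lia.
split=> //; exists rest; split.
- apply: (base_ext _ B) => v vn; rewrite /exempt /= negb_or => /andP[nv nr].
  apply/orP; left; apply: contra nr => /andP[jv ->]; rewrite andbT addn1.
  rewrite ltn_neqAle jv andbT; apply: contra nv => /eqP E.
  by have [_ <-] := perm_pos (b_buckets B) vn; rewrite E.
- split=> //; try lia.
  by move=> v vn jv; apply: mvs => //; lia.
- by rewrite cp; split=> //; lia.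
- by rewrite mvs ?cp ?leqnn //; lia.
Qed.

(** The new key lies between [last] and the old key, so [y] stays in the block of its bucket and at
    worst becomes [movable], which phase 6 repairs. A settled [y] is never improved, its key being
    at most [last]. If [last] is INF, nothing is improved at all, so no walk has to be exhibited for
    the new key. *)
Lemma dinv_relax ret i src h last cv j en a D perm pos bk st phi :
  dinv (DState 8 ret i src h last cv j en a D perm pos bk st) phi ->
  0 < phi /\ dinv (dstep (DState 8 ret i src h last cv j en a D perm pos bk st)) phi.-1.
Proof.
move=> [sn [rest [B /= C le]]]; rewrite /dstep; have := list_atP C.
case: eqP => [a0 r0|a0 [rest' [r0 C' _]]].
  split; first by lia.
  by split=> //; exists rest; split=> //=; lia.
have potE : pot_base h pos bk rest' + 3 = pot_base h pos bk rest.
  by rewrite /pot_base r0 /=; lia.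
split; first by lia.
have [bu hb lb se op sr go s0 rl re] := B.
set y := inp a - 1; set wt := inp (a + 1) in r0 *.
have [/andP[yb0 _] R] : (0 < inp a <= n) && (wt <= wmax) /\ (last = INF \/ reach src (inp a).-1 (last + wt)).
  by apply: re; rewrite r0 mem_head.
rewrite -subn1 -/y in R.
have yn : y < n by rewrite /y; lia.
have cov x z t : x < n -> pos x < h -> (z, t) \in adj x ->
    D z.-1 <= D x + t \/ D x = last /\ ((z, t) \in rest' \/ z.-1 = y /\ t = wt).
  move=> xn hx zx; have [|[E]] := rl _ _ _ xn hx zx; first by left.
  rewrite r0 inE => /orP[/eqP [-> ->]|zr]; right; split=> //.
    by right; rewrite -subn1.
  by left.
case: ltnP => [lt|ge].
  have yop : h <= pos y.
    by rewrite leqNgt; apply/negP => /(se _ yn); clear -lt; lia.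
  have [ly qy] := op _ yn yop.
  have Dle v : seta D y (last + wt) v <= D v by rewrite setaE; case: eqP => [->|_]; [exact: ltnW|].
  have Dne v : v <> y -> seta D y (last + wt) v = D v by rewrite setaE; case: eqP.
  have Dse v : v < n -> pos v < h -> seta D y (last + wt) v = D v.
    by move=> vn hv; apply: Dne => E; move: hv yop; rewrite E; clear; lia.
  split=> //; exists rest'; split.
  - split=> //.
    + by move=> v vn hv; rewrite Dse // se.
    + move=> v vn hv; rewrite setaE; case: eqP => [E|_]; last exact: op.
      rewrite E; split; first by apply: leq_addr.
      apply/eqP; rewrite eqn_leq; apply/andP; split.
        by rewrite -qy; apply: leq_div2r; apply: ltnW.
      by apply: leq_div2r; apply: leq_addr.
    + move=> v vn hv; rewrite /exempt orbF => /eqP nv.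
      by rewrite /movable Dne //; apply: sr.
    + move=> v vn; have [gv rv] := go _ vn.
      split; first by apply: leq_trans (Dle _) gv.
      rewrite setaE; case: eqP => [->|_] //.
      case: R => [E|R]; last by right.
      by have [] := go _ yn; clear -E lt; lia.
    + rewrite setaE; case: eqP => // E; move: lt; rewrite -E s0; clear; lia.
    + move=> x z t xn hx zx; rewrite (Dse x) //.
      have [le'|[E [zr|[-> ->]]]] := cov _ _ _ xn hx zx.
      * by left; apply: leq_trans (Dle _) le'.
      * by right.
      * by left; rewrite setaE eqxx E.
    + by move=> z t zr; apply: re; rewrite r0 inE zr orbT.
  - exact: C'.
  - by split.
  - by rewrite /=; case: ifP => _; clear -le potE; lia.
split=> //; exists rest'; split=> //.
- split=> //.
  + move=> x z t xn hx zx; have [le'|[E [zr|[-> ->]]]] := cov _ _ _ xn hx zx.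
    * by left.
    * by right.
    * by left; rewrite E.
  + by move=> z t zr; apply: re; rewrite r0 inE zr orbT.
- by rewrite /=; clear -le potE; lia.
Qed.

Lemma dinv_step d phi :
  dinv d phi -> dph d <> 9 -> 0 < phi /\ dinv (dstep d) phi.-1.
Proof.
case: d => ph ret i src h last cv j en a D perm pos bk st I /= n9.
have : ph \in [:: 3; 4; 5; 6; 7; 8].
  by case: I n9 => _; case: (ph) => [|[|[|[|[|[|[|[|[|[|]]]]]]]]]].
rewrite !inE => /or4P[/eqP E|/eqP E|/eqP E|/or3P[/eqP E|/eqP E|/eqP E]]; subst ph.
- exact: dinv_init.
- exact: dinv_start.
- exact: dinv_extract.
- exact: dinv_move.
- exact: dinv_redistribute.
- exact: dinv_relax.
Qed.
End Dijkstra.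

(** * Emission of the results *)

Record estate := EState {
  eem : nat; eli : nat; enl : nat; elv : nat; eea : nat; ebv : nat; ebw : nat;
  ee : nat; eo : nat; ecnt : nat;
  elow : nat -> nat; efirst : nat -> nat; eold : nat -> nat; elog : seq triple }.

(** The indices to skip are o and first o - 1. They may be adjacent in either order, hence the test
    for o both before and after the other one. *)
Definition norm (e o : nat) (first : nat -> nat) : nat :=
  let e1 := if e == o then e + 1 else e in
  let e2 := if e1 + 1 == first o then e1 + 1 else e1 in
  if e2 == o then e2 + 1 else e2.

Section Emission.
Variables (w : nat) (inp : nat -> nat) (n M wmax B : nat) (adj : nat -> seq (nat * nat)).

Hypothesis n_ge2 : 2 <= n.
Hypothesis adj_list : forall v, v < n -> list_at w inp (inp (v * 2 + 2)) (adj v).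
Hypothesis adj_bound : forall (v y wt : nat), v < n -> (y, wt) \in adj v ->
  (0 < y <= n) && (wt <= wmax).
Hypothesis budget : forall r, n <= 4 * r -> pot_start n M adj + 2 <= B * r.

Local Notation INF := (2 ^ M).
Local Notation isD := (isD adj).
Local Notation reach := (reach adj).
Local Notation row_ok := (row_ok n M adj).
Local Notation dinv := (dinv w inp n M wmax adj).

(* Once the current run of Dijkstra's algorithm is over there is no need to wait
   before the next output. *)
Definition thr (ph : nat) : nat := if ph == 9 then 0 else B.

(** Once the last row has been computed the phase remains 9, so its outputs follow without waiting;
    [src = n] then tells the next call to stop. *)
Definition advance (d : dstate) (x : estate) : dstate * estate :=
  let 'DState ph ret i src h last cv j en a D perm pos bk st := d in
  let 'EState em li nl lv ea bv bw e o cnt low first old log := x in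
  if src == n then
    (DState 10 ret i src h last cv j en a D perm pos bk st,
     EState em li nl lv ea bv bw e o (cnt + 1) low first old log)
  else
    (if src + 1 == n then
       DState ph ret i (src + 1) h last cv j en a old perm pos bk st
     else DState 3 ret 0 (src + 1) h last cv j en a old perm pos bk st,
     EState 1 li nl lv ea bv bw 0 src (cnt + 1) low first D log).

(** [bv = 0] after the scan means that only loops leave the vertex, which then reaches no other
    vertex: vertex number 1 is output at infinite distance. This is a legal pair because index 0 is
    never listed in [low]. *)
Definition estep_low (d : dstate) (x : estate) : dstate * estate :=
  let 'EState em li nl lv ea bv bw e o cnt low first old log := x in
  if ea == 0 then
    if li == nl then
      if dph d == 9 then advance d x
      else (d, EState em li nl lv ea bv bw e o (cnt + 1) low first old log)
    else if cnt < thr (dph d) then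
      (d, EState em li nl lv ea bv bw e o (cnt + 1) low first old log)
    else
      let t := if bv == 0 then 1 else bv in
      let first' := seta first lv t in
      let log' := rcons log (lv + 1, t, if bv == 0 then None else Some bw) in
      if li + 1 == nl then
        (d, EState em (li + 1) nl lv ea bv bw e o 0 low first' old log')
      else
        (d, EState em (li + 1) nl (low (li + 1)) (inp (low (li + 1) * 2 + 2)) 0 bw
              e o 0 low first' old log')
  else
    let y := inp ea in let wt := inp (ea + 1) in
    let upd := (y != lv + 1) && ((bv == 0) || (wt < bw)) in
    (d, EState em li nl lv (inp (ea + 2)) (if upd then y else bv)
          (if upd then wt else bw) e o (cnt + 1) low first old log).

Definition estep_row (d : dstate) (x : estate) : dstate * estate :=
  let 'EState em li nl lv ea bv bw e o cnt low first old log := x in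
  if e == n then
    if dph d == 9 then advance d x
    else (d, EState em li nl lv ea bv bw e o (cnt + 1) low first old log)
  else if cnt < thr (dph d) then
    (d, EState em li nl lv ea bv bw e o (cnt + 1) low first old log)
  else
    (d, EState em li nl lv ea bv bw (e + 1) o 0 low first old
          (rcons log (o + 1, e + 1, if old e == INF then None else Some (old e)))).

Definition enorm (x : estate) : estate :=
  let 'EState em li nl lv ea bv bw e o cnt low first old log := x in
  EState em li nl lv ea bv bw (norm e o first) o cnt low first old log.

Definition estep (d : dstate) (x : estate) : dstate * estate :=
  if eem x == 0 then estep_low d x else estep_row d (enorm x).

Definition done_pair (o e : nat) (first : nat -> nat) (u v : nat) : bool :=
  (u < o) || ((u == o) && (v < e)) || (first u == v.+1).

Definition log_ok (log : seq triple) (P : nat -> nat -> bool) : Prop :=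
  [/\ uniq [seq x.1 | x <- log],
      forall x, x \in log -> exists u v d,
        [/\ u < n, v < n, u != v, x = (u.+1, v.+1, d) & isD u v d] &
      forall u v, u < n -> v < n -> u != v ->
        ((u.+1, v.+1) \in [seq x.1 | x <- log]) = P u v].

Lemma log_ext log P P' :
  (forall u v, u < n -> v < n -> u != v -> P' u v = P u v) ->
  log_ok log P -> log_ok log P'.
Proof. by move=> E [l1 l2 l3]; split=> // u v un vn uv; rewrite E ?l3. Qed.

Lemma log_add log P P' u v d :
  u < n -> v < n -> u != v -> ~~ P u v -> isD u v d ->
  (forall u' v', u' < n -> v' < n -> u' != v' ->
     P' u' v' = P u' v' || (u' == u) && (v' == v)) ->
  log_ok log P -> log_ok (rcons log (u.+1, v.+1, d)) P'.
Proof.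
move=> un vn uv nP Dd E [l1 l2 l3]; split.
- by rewrite map_rcons rcons_uniq l1 andbT l3.
- move=> x; rewrite mem_rcons inE => /orP[/eqP ->|/l2 //].
  by exists u, v, d.
- move=> u' v' un' vn' uv'; rewrite map_rcons mem_rcons inE l3 // E // orbC.
  by congr orb; rewrite xpair_eqE !eqSS.
Qed.

Lemma log_size log P : log_ok log P -> size log <= n * n.
Proof.
move=> [l1 l2 _]; rewrite -(size_map fst).
have -> : n * n = size [seq (u.+1, v.+1) | u <- iota 0 n, v <- iota 0 n].
  by rewrite size_allpairs size_iota.
apply: uniq_leq_size => // k /mapP [x /l2 [u [v [d [un vn _ -> _]]]] ->] /=.
by apply/allpairsP; exists (u, v); rewrite !mem_iota.
Qed.

Definition scanned (lv bv bw : nat) (rest : seq (nat * nat)) : Prop :=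
  [/\ {subset rest <= adj lv},
      bv = 0 -> forall y wt : nat, (y, wt) \in adj lv -> y <> lv + 1 -> (y, wt) \in rest &
      bv <> 0 -> [/\ (bv, bw) \in adj lv, bv <> lv + 1 &
        forall y wt : nat, (y, wt) \in adj lv -> y <> lv + 1 ->
          bw <= wt \/ (y, wt) \in rest]].

(* The number of outputs left before the row of distances being computed is
   needed. *)
Definition avail (x : estate) : nat :=
  if eem x == 0 then enl x - eli x
  else n - ee x - (ee x <= eo x) - (ee x < efirst x (eo x)).

Definition low_inv (x : estate) : Prop :=
  [/\ eo x = 0, ee x = 0 &
  [/\ eli x <= enl x, enl x <= n <= 4 * enl x,
      forall i, i < enl x -> 0 < elow x i < n /\ size (adj (elow x i)) <= B,
      forall i j, i < enl x -> j < enl x -> elow x i = elow x j -> i = j &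
  [/\ forall v, v < n -> efirst x v <> 0 -> exists2 i, i < eli x & elow x i = v,
      eli x < enl x -> elv x = elow x (eli x) /\ exists rest,
        [/\ list_at w inp (eea x) rest, ecnt x + size rest <= B &
            scanned (elv x) (ebv x) (ebw x) rest] &
      eli x = enl x -> eea x = 0 /\ ecnt x = 0]]].

(** By the last clause [advance] follows immediately on the last output of a row, so that the budget
    of the next run starts with a waiting time of 1 only. *)
Definition row_inv (src : nat) (x : estate) : Prop :=
  [/\ eo x < n, src = eo x + 1, ee x <= n, row_ok (eo x) (eold x) &
      ecnt x <= B + 1 /\ (avail x = 0 -> src < n -> ecnt x = 0)].

(* The budget: phi more steps are needed before the next row of distances is
   available, and the available outputs last for B steps each. *)
Definition cinv (slack : nat) (d : dstate) (x : estate) : Prop :=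
  [/\ log_ok (elog x) (done_pair (eo x) (ee x) (efirst x)),
      forall v, v < n -> efirst x v <= n /\ efirst x v <> v.+1,
      efirst x 0 = 0,
      exists2 phi, dinv d phi \/ [/\ dsrc d = n, dph d = 9 & eem x = 1] &
        dph d <> 9 -> phi + slack + ecnt x <= B * avail x &
      (eem x = 0 /\ dsrc d = 0 /\ low_inv x) \/ (eem x = 1 /\ row_inv (dsrc d) x)].

Definition finished (d : dstate) (x : estate) : Prop :=
  [/\ dph d = 10, ecnt x <= B + 2 & log_ok (elog x) (fun _ _ => true)].

Definition emits (x x' : estate) : Prop :=
  (elog x' = elog x /\ ecnt x' = (ecnt x).+1) \/
  (exists t, elog x' = rcons (elog x) t /\ ecnt x' = 0).

(* The first arc leaving u on a walk to another vertex. *)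
Lemma min_edge u v k :
  reach u v k -> v <> u -> exists y wt : nat, [/\ (y, wt) \in adj u, y <> u + 1 & wt <= k].
Proof.
elim=> [//|x k' y wt _ IH yx yu].
case: (x =P u) => [E|/IH [z [t [zu zn le]]]].
  by exists y.+1, wt; rewrite -E; split=> //; [lia | exact: leq_addl].
by exists z, t; split=> //; apply: leq_trans le (leq_addr _ _).
Qed.

Lemma dinv_ph9 d phi : dinv d phi -> dph d = 9 -> dsrc d < n /\ row_ok (dsrc d) (dD d).
Proof. by case: d => ph ret i src h last cv j en a D perm pos bk st [sn I] /= E; rewrite E in I. Qed.

Lemma norm_spec e o first :
  e <= n -> o < n -> first o <= n -> first o <> o.+1 ->
  let e' := norm e o first in
  [/\ e <= e' <= n, e' <> o, e' + 1 <> first o,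
      n - e' - (e' <= o) - (e' < first o) = n - e - (e <= o) - (e < first o) &
      forall v, e <= v < e' -> v = o \/ v.+1 = first o].
Proof.
move=> en on fn fo; rewrite /norm.
case: (e =P o) => E1 /=; [case: (e + 1 + 1 =P first o) | case: (e + 1 =P first o)] => E2;
  case: eqP => E3; split; try move=> v; lia.
Qed.

Lemma rem_succ e o f : e < n -> e <> o -> e + 1 <> f ->
  n - (e + 1) - (e + 1 <= o) - (e + 1 < f) = (n - e - (e <= o) - (e < f)).-1.
Proof.
move=> en eo ef.
have -> : (e + 1 <= o) = (e <= o) by lia.
have -> : (e + 1 < f) = (e < f) by lia.
by case: (e <= o); case: (e < f) => /=; lia.
Qed.

(** A new row has n - 1 outputs, or n - 2 after an early pair. Early pairs concern src > 0 only, so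
    if another run follows then n >= 3, and n - 2 is at least n / 4. The last row may be empty, as
    can happen for n = 2, but no run has to be covered by it. *)
Lemma advance_inv d x :
  cinv 1 d x -> dph d = 9 ->
  (eem x = 0 /\ eli x = enl x) \/ (eem x = 1 /\ ee x = n) ->
  let: (d', x') := advance d x in
  (cinv 0 d' x' \/ finished d' x') /\ emits x x'.
Proof.
case: d => ph ret i src h last cv j en a D perm pos bk st.
case: x => em li nl lv ea bv bw e o cnt low first old log.
move=> [/= lo fi f0 [phi dp _] mode] ph9 fin; subst ph.
have mode' : cnt <= B + 1 /\ (src < n -> cnt = 0 /\
    (log_ok log (done_pair src 0 first)) /\ (em = 0 -> src = 0)).
  case: mode => [[em0 [s0 [/= o0 e0 [lin nln lows inj [Lf Ll Lr]]]]]|[em1 [/= on so e_n ro [cb cr]]]].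
    case: fin => [[_ lie]|[em1 _]]; last by rewrite em1 in em0.
    have [_ c0] := Lr lie; rewrite c0; split=> // _; split=> //; split=> //.
    by move: lo; rewrite o0 e0 s0.
  case: fin => [[em0 _]|[_ eN]]; first by rewrite em0 in em1.
  split=> // sn; split.
    apply: cr => //; rewrite /avail /= em1 /= eN; lia.
  split; last by rewrite em1.
  apply: log_ext lo => u v un vn _; rewrite /done_pair so eN.
  by congr orb; rewrite vn andbT ltn0 andbF orbF addn1 ltnS leq_eqVlt orbC.
have [cb sl] := mode'; rewrite /advance; case: eqP => [sN|sN].
  split; last by left; rewrite /= addn1.
  right; split=> //=; first by lia.
  case: mode => [[em0 [s0 _]]|[em1 [/= on so e_n _ _]]]; first by lia.
  case: fin => [[em0 _]|[_ eN]]; first by rewrite em0 in em1.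
  apply: log_ext lo => u v un vn _; rewrite /done_pair eN vn.
  by have -> : (u < o) || (u == o) && true by lia.
have {dp} [sn ro] : src < n /\ row_ok src D.
  by case: dp => [dd|[/= E]] //; exact: (dinv_ph9 dd erefl).
have [c0 [lo' es]] := sl sn; split; last by left; rewrite /= addn1.
left; have fs := fi _ sn; split=> //.
- have phi0 : dinv (DState 3 ret 0 src.+1 h last cv j en a old perm pos bk st)
       (pot_start n M adj) \/ src.+1 = n.
    case: (src.+1 =P n) => [->|ne]; [by right | left].
    by split; [lia | split=> //; rewrite /pot_start; lia].
  case: eqP => [E|ne]; [exists 0 | exists (pot_start n M adj)] => //.
  + by right; split.
  + by case: phi0 => [|E]; [rewrite addn1; left | case: ne; rewrite addn1].
  + move=> _; rewrite c0 /= addn0 /avail /=.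
    apply: leq_trans (budget (r := n - 0 - 1 - (0 < first src)) _); first by lia.
    case: (src =P 0) => [->|s0]; first by rewrite f0; lia.
    case: (0 < first src); lia.
- right; split; first by [].
  have -> : dsrc (if src + 1 == n then DState 9 ret i (src + 1) h last cv j en a old perm pos bk st
     else DState 3 ret 0 (src + 1) h last cv j en a old perm pos bk st) = src + 1 by case: ifP.
  split=> //=; split; first by lia.
  rewrite /avail /= c0; case: (src =P 0) => [->|s0]; first by rewrite f0; lia.
  case: (0 < first src); lia.
Qed.

Lemma estep_low_inv d x :
  cinv 1 d x -> eem x = 0 ->
  let: (d', x') := estep_low d x in
  (cinv 0 d' x' \/ finished d' x') /\ emits x x'.
Proof.
case: x => em li nl lv ea bv bw e o cnt low first old log I em0.
rewrite /estep_low; have [/= lo fi f0 [phi dp bud] mode] := I; rewrite /= in em0; subst em.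
rewrite /avail /= in bud.
case: mode => [[_ [s0 [/= o0 e0 [lin nln lows inj [Lf Ll Lr]]]]]|[]//].
case: (ea =P 0) => ea0.
  case: (li =P nl) => lie.
    case: eqP => p9; first by apply: advance_inv => //; left.
    (* The early pairs cannot be exhausted during the run: the budget would be 0, while the slack is
       1. *)
    by have := bud p9; rewrite lie subnn muln0; lia.
  have lilt : li < nl by lia.
  have [lvE [rest [Lr' cb [sub sc0 sc1]]]] := Ll lilt.
  have rest0 : rest = [::] by have := list_atP Lr'; rewrite ea0.
  rewrite rest0 /= in cb sub sc0 sc1.
  case: ltnP => cth.
    have cB : cnt < B by move: cth; rewrite /thr; case: ifP.
    split; last by left; rewrite /= addn1.
    left; split=> //=; first by exists phi => // /bud; rewrite /avail /=; lia.
    left; split=> //; split=> //; split=> //; split=> //; split=> //= _; split=> //.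
    by exists [::]; rewrite ea0 /=; split=> //; lia.
  have [lvn szl] := lows _ lilt; rewrite -lvE in lvn szl.
  have lvn' : lv < n by case/andP: lvn.
  set t := if bv == 0 then 1 else bv.
  set ob := if bv == 0 then None else Some bw.
  have [tn tl td] : [/\ 0 < t <= n, t <> lv + 1 & isD lv t.-1 ob].
    rewrite /t /ob; case: eqP => b0.
      split; [lia|lia|] => k /min_edge H; have [|y [wt [yl yn _]]] := H; first by rewrite /=; lia.
      by have := sc0 b0 _ _ yl yn.
    have [bl bn bm] := sc1 b0; have /andP[bb _] := adj_bound lvn' bl; split=> //.
    split.
      have -> : bw = 0 + bw by [].
      by apply: reachS (reach0 _ _) _; rewrite prednK //; lia.
    move=> k /min_edge H; have [|y [wt [yl yn le]]] := H; first by lia.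
    by have [|//] := bm _ _ yl yn => le'; apply: leq_trans le' le.
  set first' := seta first lv t.
  (* The list [low] has no repetition, so no early pair from [lv] has been output yet. *)
  have flv : first lv = 0.
    apply/eqP; case: eqP => // /(Lf _ lvn') [k kl kE].
    by have := inj k li ltac:(lia) lilt ltac:(congruence); lia.
  have lo' : log_ok (rcons log (lv + 1, t, ob)) (done_pair o e first').
    have -> : (lv + 1, t, ob) = (lv.+1, t.-1.+1, ob) by rewrite addn1 prednK //; case/andP: tn.
    apply: log_add lo => //; rewrite ?o0 ?e0; try lia.
    - by rewrite /done_pair flv; lia.
    - move=> u v un vn uv; rewrite /done_pair /first' setaE.
      by case: (u =P lv) => [->|_]; rewrite ?flv; clear -tn o0 e0; lia.
  have fi' v : v < n -> first' v <= n /\ first' v <> v.+1.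
    move=> vn; rewrite /first' setaE; case: eqP => [->|_]; last exact: fi.
    by split; lia.
  have f0' : first' 0 = 0 by rewrite /first' setaE; case: eqP => // E; lia.
  have Lf' v : v < n -> first' v <> 0 -> exists2 k, k < li + 1 & low k = v.
    move=> vn; rewrite /first' setaE; case: eqP => [-> _|_ /(Lf _ vn) [k kl kE]].
      by exists li => //; lia.
    by exists k => //; lia.
  (* During a run an output comes only after at least B iterations of waiting, which is the share of
     one output in the budget. *)
  have bud' : dph d <> 9 -> phi <= B * (nl - (li + 1)).
    move=> p9; have := bud p9; move: cth; rewrite /thr; case: eqP => // _ cB.
    have -> : nl - li = (nl - (li + 1)) + 1 by lia.
    by rewrite mulnDr; lia.
  case: (li + 1 =P nl) => lie'; (split; last by right; exists (lv + 1, t, ob)); left; split=> //=.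
  - by exists phi => // /bud'; rewrite /avail /=; lia.
  - left; split=> //; split=> //; split=> //=; split=> //=; first by lia.
    by split=> //; lia.
  - by exists phi => // /bud'; rewrite /avail /=; lia.
  - left; split=> //; split=> //; split=> //=; split=> //=; first by lia.
    have lin' : li + 1 < nl by lia.
    have [l1 l2] := lows _ lin'.
    split=> //; split=> //; exists (adj (low (li + 1))); split=> //; last by split.
    by apply: adj_list; case/andP: l1.
have lilt : li < nl.
  by have [//|le] := ltnP li nl; have [|] := Lr _ => //; lia.
have [lvE [rest [Lr' cb [sub sc0 sc1]]]] := Ll lilt.
have := list_atP Lr'; case: eqP => // _ [rest' [rE Lr'' _]].
split; last by left; rewrite /= addn1.
left; split=> //=; first by exists phi => // /bud; rewrite /avail /=; lia.
left; split=> //; split=> //; split=> //=; split=> //; split=> //=; last by lia.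
move=> _; split=> //; exists rest'; split=> //; first by move: cb; rewrite rE /=; lia.
set y := inp ea; set wt := inp (ea + 1) in rE *.
rewrite -/y in rE.
have yl : (y, wt) \in adj lv by apply: sub; rewrite rE mem_head.
have mem z s : (z, s) \in rest -> (z = y /\ s = wt) \/ (z, s) \in rest'.
  by rewrite rE inE => /orP[/eqP [-> ->]|]; [left|right].
have y0 : y <> 0.
  have lvn : lv < n by rewrite lvE; case: (lows _ lilt) => /andP[].
  by have /= := adj_bound lvn yl; lia.
split.
- by move=> z zr; apply: sub; rewrite rE inE zr orbT.
- case: ifP => [_|nu b0 z s zl zn]; first by [].
  have [[E _]|//] := mem _ _ (sc0 b0 _ _ zl zn).
  by move: nu; rewrite b0 /= andbT -E => /negbFE/eqP.
- case: ifP => [/andP[/eqP yn up] _|nu b0].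
    split=> // z s zl zn; case: (bv =P 0) up => [b0 _|b0 /= lt].
      by have [[_ ->]|] := mem _ _ (sc0 b0 _ _ zl zn); [left|right].
    have [bl bn bm] := sc1 b0; have [le|/mem [[_ ->]|]] := bm _ _ zl zn.
    + by left; apply: leq_trans (ltnW lt) le.
    + by left.
    + by right.
  have [bl bn bm] := sc1 b0; split=> // z s zl zn.
  have [le|/mem [[E ->]|]] := bm _ _ zl zn; [by left| |by right].
  left; move: nu; rewrite -E; case: eqP => //= _.
  by case: eqP => //= _; lia.
Qed.

Lemma estep_row_inv d x :
  cinv 1 d x -> eem x = 1 ->
  let: (d', x') := estep_row d (enorm x) in
  (cinv 0 d' x' \/ finished d' x') /\ emits x x'.
Proof.
case: x => em li nl lv ea bv bw e o cnt low first old log I em1.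
have [/= lo fi f0 [phi dp bud] mode] := I; rewrite /= in em1; subst em.
rewrite /avail /= in bud.
case: mode => [[]//|[_ [/= on so en ro [cb cr]]]].
have [fon foo] := fi _ on.
have [/andP[ee' en'] neo nef remE skip] := norm_spec en on fon foo.
rewrite /enorm; set e' := norm e o first in ee' en' neo nef remE skip *.
clearbody e'.
have lo' : log_ok log (done_pair o e' first).
  apply: log_ext lo => u v un vn uv; rewrite /done_pair.
  case: (u =P o) => [E|_] //=; rewrite E ltnn /=.
  case: (ltnP v e) => ve /=; first by rewrite (leq_trans ve ee').
  case: (ltnP v e') => ve' //=.
  have [E'|<-] := skip v ltac:(lia); last by rewrite eqxx.
  by move: uv; rewrite E E' eqxx.
have I' : cinv 1 d (EState 1 li nl lv ea bv bw e' o cnt low first old log).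
  split=> //=; first by exists phi => //; rewrite /avail /= remE.
  by right; split=> //; split=> //=; split=> //; move: cr; rewrite /avail /= remE.
rewrite /estep_row; case: (e' =P n) => eN.
  case: eqP => p9.
    have := advance_inv I' p9 (or_intror (conj erefl eN)).
    by case: (advance _ _) => d' x' [H1 H2].
  by have := bud p9; rewrite -remE eN subnn !sub0n muln0 addn1.
case: ltnP => cth.
  have cB : cnt < B by move: cth; rewrite /thr; case: ifP.
  split; last by left; rewrite /= addn1.
  left; split=> //=; first by exists phi => // /bud; rewrite /avail /= remE; lia.
  right; split=> //; split=> //=; split; first by lia.
  rewrite /avail /= => r0 _; have p9 : dph d <> 9 by move: cth; rewrite /thr; case: eqP.
  by have := bud p9; rewrite -remE r0 muln0 addn1.
split; last by right; exists (o + 1, e' + 1, if old e' == INF then None else Some (old e')).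
have en2 : e' < n by lia.
have remE' := rem_succ en2 neo nef.
left; split=> //=.
- rewrite !addn1; apply: log_add (ro _ en2) _ lo' => //.
  + by apply/eqP => E; apply: neo.
  + rewrite /done_pair ltnn ltnn andbF /=; apply/eqP => E; apply: nef; by rewrite E addn1.
  + move=> u v un vn uv; rewrite /done_pair.
    have -> : (v < e'.+1) = (v == e') || (v < e') by rewrite ltnS leq_eqVlt.
    by case: (u == o); case: (v == e'); case: (v < e'); case: (u < o); case: (first u == _).
- exists phi => // p9; have := bud p9; rewrite /avail /= -remE.
  move: cth; rewrite /thr; case: eqP => // _ cB.
  rewrite remE'; case: (_ - _) => [|r /=]; first by rewrite muln0; clear; lia.
  by rewrite mulnS; clear -cB; lia.
- by right; split=> //; split=> //=; clear -en2; lia.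
Qed.

Lemma estep_inv d x :
  cinv 1 d x ->
  let: (d', x') := estep d x in
  (cinv 0 d' x' \/ finished d' x') /\ emits x x'.
Proof.
move=> I; rewrite /estep; case: eqP => [em0|em1]; first exact: estep_low_inv.
by apply: estep_row_inv => //; case: I => _ _ _ _ [[]|[]].
Qed.

Lemma cinv_bound k d x : cinv k d x -> ecnt x <= B + 2 /\ size (elog x) <= n * n.
Proof.
move=> [lo _ _ _ mode]; split; last exact: log_size lo.
case: mode => [[_ [_ [_ _ [lin _ _ _ [_ Ll Lr]]]]]|[_ [_ _ _ _ [cb _]]]]; last by lia.
case: (ltnP (eli x) (enl x)) => [/Ll [_ [rest [_ cb _]]]|le]; first by lia.
by have [|_ ->] := Lr _ => //; lia.
Qed.
End Emission.

(** * The program *)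

Coercion Rg : nat >-> operand.
(* Registers 0 to 9 belong to Dijkstra's algorithm, 10 to 14 are parameters, 15
   to 24 belong to the emission and 25 to 28 to the preprocessing.  The phase rPH
   is 0 to 2 during the preprocessing, then 3 (clear the vertices), 4 (clear the
   buckets), 5 (extract the minimum), 6 (move rV down, then go to phase rRET),
   7 (redistribute a bucket), 8 (relax the arcs), 9 (row complete), 10 (halt). *)
Local Notation rPH := 0 (only parsing).
Local Notation rRET := 1 (only parsing).
Local Notation rI := 2 (only parsing).
Local Notation rSRC := 3 (only parsing).
Local Notation rH := 4 (only parsing).
Local Notation rLAST := 5 (only parsing).
Local Notation rV := 6 (only parsing).
Local Notation rJ := 7 (only parsing).
Local Notation rEN := 8 (only parsing).
Local Notation rA := 9 (only parsing).
Local Notation rN := 10 (only parsing).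
Local Notation rM := 11 (only parsing).
Local Notation rINF := 12 (only parsing).
Local Notation rB := 13 (only parsing).
Local Notation rTH := 14 (only parsing).
Local Notation rCNT := 15 (only parsing).
Local Notation rEM := 16 (only parsing).
Local Notation rLI := 17 (only parsing).
Local Notation rNL := 18 (only parsing).
Local Notation rLV := 19 (only parsing).
Local Notation rEA := 20 (only parsing).
Local Notation rBV := 21 (only parsing).
Local Notation rBW := 22 (only parsing).
Local Notation rE := 23 (only parsing).
Local Notation rO := 24 (only parsing).
Local Notation rPW := 25 (only parsing).
Local Notation rL := 26 (only parsing).
Local Notation rMS := 27 (only parsing).
Local Notation rQ := 28 (only parsing).
Local Notation t1 := 30 (only parsing).
Local Notation t2 := 31 (only parsing).
Local Notation t3 := 32 (only parsing).
Local Notation t4 := 33 (only parsing).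
Local Notation t5 := 34 (only parsing).
Local Notation fD := 0 (only parsing).
Local Notation fOLD := 1 (only parsing).
Local Notation fPERM := 2 (only parsing).
Local Notation fPOS := 3 (only parsing).
Local Notation fBK := 4 (only parsing).
Local Notation fST := 5 (only parsing).
Local Notation fLOW := 6 (only parsing).
Local Notation fFIRST := 7 (only parsing).
Local Notation "c1 ;; c2" := (CSeq c1 c2) (at level 60, right associativity).

Definition dijk_init : cmd :=
  CIfEq rI rN
    (CSet rI (Im 0) ;; CSet rPH (Im 4))
    (CPut fD rI rINF ;; CPut fPERM rI rI ;; CPut fPOS rI rI ;;
     COp Add t1 rM (Im 1) ;; CPut fBK rI t1 ;; COp Add rI rI (Im 1)).

Definition dijk_start : cmd :=
  COp Add t1 rM (Im 2) ;;
  CIfEq rI t1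
    (CPut fST rI rN ;; CPut fD rSRC (Im 0) ;; CSet rLAST (Im 0) ;; CSet rH (Im 0) ;;
     CSet rV rSRC ;; CSet rRET (Im 5) ;; CSet rPH (Im 6))
    (CPut fST rI (Im 0) ;; COp Add rI rI (Im 1)).

Definition dijk_extract : cmd :=
  CIfEq rH rN
    (CSet rPH (Im 9) ;; CSet rTH (Im 0))
    (CGet t1 fPERM rH ;; CGet t2 fBK t1 ;;
     CIfEq t2 (Im 0)
       (COp Add rH rH (Im 1) ;; COp Mul t3 t1 (Im 2) ;; COp Add t3 t3 (Im 2) ;;
        CInp rA t3 ;; CSet rPH (Im 8))
       (CGet t3 fD t1 ;; COp Defs.Sub t4 t2 (Im 1) ;; COp Shr t3 t3 t4 ;;
        COp Shl rLAST t3 t4 ;; CSet rJ rH ;; COp Add t2 t2 (Im 1) ;;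
        CGet rEN fST t2 ;; CSet rPH (Im 7))).

Definition dijk_move : cmd :=
  CGet t1 fBK rV ;;
  CIfEq t1 (Im 0) (CSet rPH rRET)
    (COp Defs.Sub t2 t1 (Im 1) ;; CGet t3 fD rV ;; COp Shr t3 t3 t2 ;;
     COp Shr t4 rLAST t2 ;;
     CIfEq t3 t4
       (CGet t3 fST t1 ;; CGet t4 fPERM t3 ;; CGet t5 fPOS rV ;;
        CPut fPERM t3 rV ;; CPut fPERM t5 t4 ;; CPut fPOS rV t3 ;; CPut fPOS t4 t5 ;;
        COp Add t3 t3 (Im 1) ;; CPut fST t1 t3 ;; CPut fBK rV t2)
       (CSet rPH rRET)).

Definition dijk_redistribute : cmd :=
  CIfEq rJ rEN (CSet rPH (Im 5))
    (CGet rV fPERM rJ ;; COp Add rJ rJ (Im 1) ;; CSet rRET (Im 7) ;; CSet rPH (Im 6)).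

Definition dijk_relax : cmd :=
  CIfEq rA (Im 0) (CSet rPH (Im 5))
    (CInp t1 rA ;; COp Defs.Sub t1 t1 (Im 1) ;; COp Add t2 rA (Im 1) ;; CInp t2 t2 ;;
     COp Add t3 rA (Im 2) ;; CInp rA t3 ;; COp Add t2 rLAST t2 ;; CGet t3 fD t1 ;;
     CIfLt t2 t3
       (CPut fD t1 t2 ;; CSet rV t1 ;; CSet rRET (Im 8) ;; CSet rPH (Im 6))
       CSkip).

Definition dijk : cmd :=
  CIfEq rPH (Im 3) dijk_init (CIfEq rPH (Im 4) dijk_start (CIfEq rPH (Im 5) dijk_extract
  (CIfEq rPH (Im 6) dijk_move (CIfEq rPH (Im 7) dijk_redistribute
  (CIfEq rPH (Im 8) dijk_relax CSkip))))).

Definition emit_advance : cmd :=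
  CIfEq rSRC rN (CSet rPH (Im 10) ;; COp Add rCNT rCNT (Im 1))
    (CSwap fD fOLD ;; CSet rO rSRC ;; CSet rE (Im 0) ;; CSet rEM (Im 1) ;;
     COp Add rSRC rSRC (Im 1) ;; COp Add rCNT rCNT (Im 1) ;;
     CIfEq rSRC rN CSkip (CSet rPH (Im 3) ;; CSet rI (Im 0) ;; CSet rTH rB)).

Definition emit_low : cmd :=
  CIfEq rEA (Im 0)
    (CIfEq rLI rNL
       (CIfEq rPH (Im 9) emit_advance (COp Add rCNT rCNT (Im 1)))
       (CIfLt rCNT rTH (COp Add rCNT rCNT (Im 1))
          (COp Add t1 rLV (Im 1) ;;
           CIfEq rBV (Im 0)
             (CEmitInf t1 (Im 1) ;; CPut fFIRST rLV (Im 1))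
             (CEmit t1 rBV rBW ;; CPut fFIRST rLV rBV) ;;
           CSet rCNT (Im 0) ;; COp Add rLI rLI (Im 1) ;;
           CIfEq rLI rNL CSkip
             (CGet rLV fLOW rLI ;; COp Mul t1 rLV (Im 2) ;; COp Add t1 t1 (Im 2) ;;
              CInp rEA t1 ;; CSet rBV (Im 0)))))
    (CInp t1 rEA ;; COp Add t2 rEA (Im 1) ;; CInp t2 t2 ;; COp Add t3 rEA (Im 2) ;;
     CInp rEA t3 ;; COp Add rCNT rCNT (Im 1) ;; COp Add t3 rLV (Im 1) ;;
     CIfEq t1 t3 CSkip
       (CIfEq rBV (Im 0) (CSet rBV t1 ;; CSet rBW t2)
          (CIfLt t2 rBW (CSet rBV t1 ;; CSet rBW t2) CSkip))).

Definition emit_norm : cmd :=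
  CIfEq rE rO (COp Add rE rE (Im 1)) CSkip ;;
  CGet t1 fFIRST rO ;; COp Add t2 rE (Im 1) ;;
  CIfEq t2 t1 (COp Add rE rE (Im 1)) CSkip ;;
  CIfEq rE rO (COp Add rE rE (Im 1)) CSkip.

Definition emit_row : cmd :=
  CIfEq rE rN
    (CIfEq rPH (Im 9) emit_advance (COp Add rCNT rCNT (Im 1)))
    (CIfLt rCNT rTH (COp Add rCNT rCNT (Im 1))
       (CGet t1 fOLD rE ;; COp Add t2 rO (Im 1) ;; COp Add rE rE (Im 1) ;;
        CIfEq t1 rINF (CEmitInf t2 rE) (CEmit t2 rE t1) ;;
        CSet rCNT (Im 0))).

Definition emit : cmd := CIfEq rEM (Im 0) emit_low (emit_norm ;; emit_row).

Definition pre_start : cmd :=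
  CInp rN (Im 0) ;; CSet rPW (Im 1) ;;
  CIfLt rN (Im 2) (CSet rPH (Im 10)) (CSet rPH (Im 1)).

Definition pre_sum (c : nat) : cmd :=
  CIfEq rI rN
    (COp Div rQ rMS rN ;; COp Mul rM rL (Im (c + 1)) ;; COp Shl rINF (Im 1) rM ;;
     COp Mul t1 rM (Im 24) ;; COp Mul t2 rQ (Im 12) ;; COp Add rB t1 t2 ;;
     COp Add rB rB (Im 160) ;; CSet rTH rB ;; COp Mul rQ rQ (Im 2) ;;
     COp Add rQ rQ (Im 2) ;; CSet rI (Im 1) ;; CSet rPH (Im 2))
    (COp Mul t1 rI (Im 2) ;; COp Add t1 t1 (Im 1) ;; CInp t1 t1 ;; COp Add rMS rMS t1 ;;
     COp Add rI rI (Im 1) ;;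
     CIfEq rI rPW (COp Add rPW rPW rPW ;; COp Add rL rL (Im 1)) CSkip).

(** [rI] starts at 1, which keeps the first vertex off the list. The list is never empty in the end,
    so its entry 0 is a valid first vertex to scan. *)
Definition pre_low : cmd :=
  CIfEq rI rN
    (CGet rLV fLOW (Im 0) ;; COp Mul t1 rLV (Im 2) ;; COp Add t1 t1 (Im 2) ;;
     CInp rEA t1 ;; CSet rI (Im 0) ;; CSet rPH (Im 3))
    (COp Mul t1 rI (Im 2) ;; COp Add t1 t1 (Im 1) ;; CInp t1 t1 ;;
     CIfLt t1 rQ (CPut fLOW rNL rI ;; COp Add rNL rNL (Im 1)) CSkip ;;
     COp Add rI rI (Im 1)).

Definition body (c : nat) : cmd :=
  CIfLt rPH (Im 3)
    (CIfEq rPH (Im 0) pre_start (CIfEq rPH (Im 1) (pre_sum c) pre_low))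
    (dijk ;; emit).

(** * The commands follow the transition systems without overflow *)

Definition absD (s : state) : dstate :=
  DState (rg s 0) (rg s 1) (rg s 2) (rg s 3) (rg s 4) (rg s 5) (rg s 6) (rg s 7)
    (rg s 8) (rg s 9) (fd s 0) (fd s 2) (fd s 3) (fd s 4) (fd s 5).

Definition absE (s : state) : estate :=
  EState (rg s 16) (rg s 17) (rg s 18) (rg s 19) (rg s 20) (rg s 21) (rg s 22)
    (rg s 23) (rg s 24) (rg s 15) (fd s 6) (fd s 7) (fd s 1) (out s).

(** The explicit list of constants keeps arithmetic, in particular powers of 2, folded. *)
Ltac wp_compute :=
  cbv beta iota delta [wp opval natop natop_ok rg fd out setr setf swapf Nat.eqb absD absE
    dijk_init dijk_start dijk_extract dijk_move dijk_redistribute dijk_relax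
    emit_norm emit_advance pre_start pre_sum pre_low].

Ltac wp_split := repeat match goal with |- _ /\ _ => split end; try exact: isT.

Section Steps.
Variables (w N : nat) (inp : nat -> nat) (n M wmax B : nat) (adj : nat -> seq (nat * nat)).
Local Notation W := (2 ^ w).
Hypothesis n_ge2 : 2 <= n.
Hypothesis adj_list : forall v, v < n -> list_at w inp (inp (v * 2 + 2)) (adj v).
Hypothesis adj_bound : forall (v y wt : nat), v < n -> (y, wt) \in adj v ->
  (0 < y <= n) && (wt <= wmax).
Hypotheses (nN : n + 1 <= N) (MN : M + 2 <= N) (NW : N * 2 + 2 < W).
Hypotheses (INFW : 2 ^ M + wmax < W) (BW : B + 3 < W).

Definition consts (s : state) : Prop :=
  [/\ rg s 10 = n, rg s 11 = M, rg s 12 = 2 ^ M & rg s 13 = B].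

Definition dijk_post (s s' : state) : Prop :=
  [/\ absD s' = dstep inp n M (absD s), absE s' = absE s, consts s' &
      rg s' 14 = thr B (rg s' 0)].

Local Notation pre phi s := (consts s /\ rg s 14 = thr B (rg s 0) /\
  dinv w inp n M wmax adj (absD s) phi).

Lemma wp_init phi s : rg s 0 = 3 -> pre phi s -> wp w N inp dijk_init (dijk_post s) s.
Proof.
case: s => r f l; rewrite /dijk_post /consts.
wp_compute.
move=> p3; rewrite p3 => -[[cN cM cI cB] [th I]]; rewrite /dinv in I.
have {I} [sn [i_n _ _]] := I.
rewrite cN cM cI; split=> E.
  by split=> //; rewrite /dstep E eqxx.
have E' : (r 2 == n) = false by apply/eqP.
do ![split=> //]; try (clear -nN MN NW i_n; lia).
by rewrite /dstep E'.
Qed.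

Lemma wp_start phi s : rg s 0 = 4 -> pre phi s -> wp w N inp dijk_start (dijk_post s) s.
Proof.
case: s => r f l; rewrite /dijk_post /consts.
wp_compute.
move=> p4; rewrite p4 => -[[cN cM cI cB] [th I]]; rewrite /dinv in I.
have {I} [sn [i_n _ _ _]] := I.
rewrite cN cM; do 2 (split; first by clear -MN NW; lia).
split=> E.
  do ![split=> //]; try (clear -nN MN NW i_n sn; lia).
  by rewrite /dstep E eqxx.
have E' : (r 2 == M + 2) = false by apply/eqP.
do ![split=> //]; try (clear -nN MN NW i_n sn; lia).
by rewrite /dstep E'.
Qed.

Lemma wp_extract phi s : rg s 0 = 5 -> pre phi s -> wp w N inp dijk_extract (dijk_post s) s.
Proof.
case: s => r f l; rewrite /dijk_post /consts.
wp_compute.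
move=> p5; rewrite p5 => -[[cN cM cI cB] [th I]]; rewrite /dinv in I.
have {I} [sn [rest [Ba _ _]]] := I.
have hn := b_h Ba; rewrite cN; split=> E.
  by split=> //; rewrite /dstep E eqxx.
have E' : (r 4 == n) = false by apply/eqP.
have hlt : r 4 < n by clear -hn E; lia.
have [un up] := pos_perm (b_buckets Ba) hlt.
have bk1 := bk_le (b_buckets Ba) un.
have [DI _] := b_good Ba un.
set u := f 2 (r 4) in un bk1 DI *.
split; first by clear -hn nN; lia.
split; first by clear -un nN; lia.
split=> b0.
  do ![split=> //]; try (clear -nN NW hn un; lia).
  by rewrite /dstep E' -/u b0.
have b0' : (f 4 u == 0) = false by apply/eqP.
(* Neither shift overflows, since both results are bounded by the key. *)
have le1 : f 0 u %/ 2 ^ (f 4 u - 1) <= f 0 u by apply: leq_div.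
have le2 : f 0 u %/ 2 ^ (f 4 u - 1) * 2 ^ (f 4 u - 1) <= f 0 u by apply: leq_trunc_div.
have MW : M + 2 < W by clear -MN NW; lia.
have DW : f 0 u < W by apply: leq_ltn_trans DI _; apply: leq_ltn_trans (leq_addr _ _) INFW.
do ![split=> //]; try (clear -nN MN NW MW hn un b0 bk1; lia).
- exact: leq_ltn_trans le1 DW.
- exact: leq_ltn_trans le2 DW.
- by rewrite /dstep E' -/u b0'.
Qed.

Lemma dinv_context ret rest h last j en a D pos bk :
  context w inp n ret h last j en a D pos bk rest -> thr B ret = B.
Proof. by case: ret => [|[|[|[|[|[|[|[|[|]]]]]]]]]. Qed.

Lemma wp_move phi s : rg s 0 = 6 -> pre phi s -> wp w N inp dijk_move (dijk_post s) s.
Proof.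
case: s => r f l; rewrite /dijk_post /consts.
wp_compute.
move=> p6; rewrite p6 => -[[cN cM cI cB] [th I]]; rewrite /dinv in I.
have {I} [sn [rest [Ba C [vn hv _] _]]] := I.
have rB := dinv_context C; rewrite /= in th.
have bk1 := bk_le (b_buckets Ba) vn.
have [DI _] := b_good Ba vn; have lI := b_last Ba.
split; first by clear -vn nN; lia.
split=> b0.
  do ![split=> //]; last by rewrite rB.
  by rewrite /dstep b0.
have b0' : (f 4 (r 6) == 0) = false by apply/eqP.
have IW : 2 ^ M < W by apply: leq_ltn_trans (leq_addr _ _) INFW.
have MW : M + 2 < W by clear -MN NW; lia.
have [bu' /andP[hi ip] yn yi by_] := buckets_move (b_buckets Ba) vn hv
  ltac:(rewrite lt0n b0'; exact: isT).
have [pn _] := perm_pos (b_buckets Ba) vn.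
do 2 (split; first by clear -b0 bk1 MW; lia).
split; first by clear -vn nN; lia.
split=> //; split; first by apply: leq_ltn_trans (leq_div _ _) _; apply: leq_ltn_trans DI IW.
split=> //; split; first by apply: leq_ltn_trans (leq_div _ _) _; apply: leq_ltn_trans lI IW.
split=> E.
  do ![split=> //]; try (clear -nN MN NW hi ip pn bk1 yn vn; lia).
  by rewrite /dstep b0' E eqxx.
have E' := introF eqP E.
do ![split=> //]; last by rewrite rB.
by rewrite /dstep b0' E'.
Qed.

Lemma wp_redistribute phi s :
  rg s 0 = 7 -> pre phi s -> wp w N inp dijk_redistribute (dijk_post s) s.
Proof.
case: s => r f l; rewrite /dijk_post /consts.
wp_compute.
move=> p7; rewrite p7 => -[[cN cM cI cB] [th I]]; rewrite /dinv in I.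
have {I} [sn [rest [Ba [_ hj je en_ _] _]]] := I.
split=> E.
  by do ![split=> //]; rewrite /dstep E eqxx.
have E' := introF eqP E.
do ![split=> //]; try (clear -nN NW je en_; lia).
by rewrite /dstep E'.
Qed.

Lemma wp_relax phi s : rg s 0 = 8 -> pre phi s -> wp w N inp dijk_relax (dijk_post s) s.
Proof.
case: s => r f l; rewrite /dijk_post /consts.
wp_compute.
move=> p8; rewrite p8 => -[[cN cM cI cB] [th I]]; rewrite /dinv in I.
have {I} [sn [rest [Ba C _]]] := I.
rewrite /= in C; have L := list_atP C; split=> E.
  by do ![split=> //]; rewrite /dstep E.
have E' : (r 9 == 0) = false by apply/eqP.
rewrite E' in L; have [rest' [r0 _ aW]] := L.
have /(b_rest Ba) [/andP[yb wb] _] : (inp (r 9), inp (r 9 + 1)) \in rest.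
  by rewrite r0 mem_head.
have lI := b_last Ba.
set y := inp (r 9) in yb *; set wt := inp (r 9 + 1) in wb *.
wp_split; try (clear -nN NW yb aW; lia); try (clear -lI wb INFW; lia).
  by move=> lt; do ![split=> //]; try (clear -nN yb; lia); rewrite /dstep E' -/y -/wt /= lt.
by move=> ge; do ![split=> //]; rewrite /dstep E' -/y -/wt /= ltnNge ge.
Qed.

Lemma wp_seq c1 c2 Q s : wp w N inp c1 (wp w N inp c2 Q) s -> wp w N inp (CSeq c1 c2) Q s.
Proof. by []. Qed.

Lemma wp_ifeq (x y : operand) c1 c2 Q s :
  (opval s x = opval s y -> wp w N inp c1 Q s) ->
  (opval s x <> opval s y -> wp w N inp c2 Q s) -> wp w N inp (CIfEq x y c1 c2) Q s.
Proof. by move=> H1 H2; split. Qed.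

Lemma wp_iflt (x y : operand) c1 c2 Q s :
  (opval s x < opval s y -> wp w N inp c1 Q s) ->
  (opval s y <= opval s x -> wp w N inp c2 Q s) -> wp w N inp (CIfLt x y c1 c2) Q s.
Proof. by move=> H1 H2; split. Qed.

Lemma wp_dijk phi s :
  consts s -> rg s 14 = thr B (rg s 0) ->
  dinv w inp n M wmax adj (absD s) phi \/ rg s 0 = 9 ->
  wp w N inp dijk (dijk_post s) s.
Proof.
move=> cs th I; have case9 : rg s 0 = 9 -> dijk_post s s.
  by move=> E; split=> //; rewrite /dstep /absD E.
have pr ph : ph <> 9 -> rg s 0 = ph -> pre phi s.
  by move=> n9 E; split=> //; split=> //; case: I => // E9; rewrite E in E9.
apply: wp_ifeq => [E|n3]; first by apply: (wp_init E); apply: pr E.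
apply: wp_ifeq => [E|n4]; first by apply: (wp_start E); apply: pr E.
apply: wp_ifeq => [E|n5]; first by apply: (wp_extract E); apply: pr E.
apply: wp_ifeq => [E|n6]; first by apply: (wp_move E); apply: pr E.
apply: wp_ifeq => [E|n7]; first by apply: (wp_redistribute E); apply: pr E.
apply: wp_ifeq => [E|n8]; first by apply: (wp_relax E); apply: pr E.
apply: case9; case: I => // -[_ I].
move: I n3 n4 n5 n6 n7 n8; rewrite /opval.
by case: (rg s 0) => [|[|[|[|[|[|[|[|[|[|k]]]]]]]]]].
Qed.

Definition emit_post (s s' : state) : Prop :=
  [/\ (absD s', absE s') = estep inp n M B (absD s) (absE s), consts s' &
      rg s' 0 = 10 \/ rg s' 14 = thr B (rg s' 0)].

Lemma wp_advance s : consts s -> rg s 0 = 9 -> rg s 14 = 0 -> rg s 3 <= n -> rg s 15 <= B + 1 ->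
  wp w N inp emit_advance (fun s' =>
    [/\ (absD s', absE s') = advance n (absD s) (absE s), consts s' &
      rg s' 0 = 10 \/ rg s' 14 = thr B (rg s' 0)]) s.
Proof.
case: s => r f l; rewrite /consts; wp_compute => -[cN cM cI cB] ph th sn cb.
split=> E.
  wp_split; first by clear -cb BW; lia.
  by split=> //; [rewrite /advance -cN E eqxx | left].
have E' : (r 3 == n) = false by apply/eqP; rewrite -cN.
wp_split; try (clear -nN NW cb BW sn; lia).
- move=> E1; do ![split=> //]; last by right; rewrite ph th.
  by rewrite /advance E' -cN E1 eqxx.
- move=> E1; do ![split=> //]; last by right.
  by rewrite /advance E' -cN (introF eqP E1).
Qed.

Lemma wp_low s : consts s -> rg s 14 = thr B (rg s 0) -> rg s 16 = 0 ->
  cinv w inp n M wmax B adj 1 (absD s) (absE s) ->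
  wp w N inp emit_low (emit_post s) s.
Proof.
move=> cs th em0 I.
have cb : rg s 15 <= B + 2 by have [] := cinv_bound n_ge2 I.
have [_ _ _ _ mode] := I; case: mode => [|[em1]]; last by have := etrans (esym em0) em1.
move=> [_ [s0 [_ _ [lin /andP[nlb _] lows _ [_ Ll Lr]]]]].
case: s cs th em0 I cb s0 lin nlb lows Ll Lr => r f l.
move=> cs th em0 I cb s0 lin nlb lows Ll Lr.
have estepE : estep inp n M B (absD (State r f l)) (absE (State r f l)) =
   estep_low inp n B (absD (State r f l)) (absE (State r f l)).
  by rewrite /estep; have -> : eem (absE (State r f l)) = 0 := em0.
have [cN cM cI cB] := cs; rewrite /emit_post estepE.
(* Naming the abstract result keeps its conditionals in [R_eq], where each branch of the command
   resolves its own test. *)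
move R_eq: (estep_low _ _ _ _ _) => R; have R0 := R_eq; rewrite /estep_low /= in R_eq.
rewrite /= in th em0 cb s0 lin nlb lows Ll Lr cN cM cI cB.
apply: wp_ifeq => E; rewrite /= in E.
- rewrite (introT eqP E) in R_eq; apply: wp_ifeq => E1; rewrite /= in E1.
    rewrite (introT eqP E1) in R_eq; apply: wp_ifeq => E2; rewrite /= in E2.
      have -> : R = advance n (absD (State r f l)) (absE (State r f l)).
        by rewrite -R0 /estep_low /= E E1 E2 !eqxx.
      have c0 : r 15 = 0 by have [] := Lr E1.
      by apply: wp_advance; rewrite // [rg _ _]/= ?th ?E2 ?c0 ?s0.
    rewrite (introF eqP E2) in R_eq.
    wp_compute; wp_split; first by clear -cb BW; lia.
    by split; [|by split|by right].
  rewrite (introF eqP E1) /= in R_eq.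
  have lilt : r 17 < r 18 by clear -lin E1; lia.
  have [lvE _] := Ll lilt; have [/andP[_ lvn] _] := lows _ lilt.
  rewrite -lvE in lvn; rewrite -th in R_eq.
  apply: wp_iflt => E2; rewrite /= in E2.
    rewrite E2 in R_eq; wp_compute; wp_split; first by clear -cb BW; lia.
    by split; [|by split|by right].
  rewrite ltnNge E2 /= in R_eq.
  have low_lt : r 17 + 1 <> r 18 -> f 6 (r 17 + 1) < n.
    by move=> ne; have [|/andP[]] := lows (r 17 + 1); first by clear -lilt ne; lia.
  wp_compute; wp_split; first by clear -lvn nN NW; lia.
    move=> b0; rewrite (introT eqP b0) /= in R_eq.
    wp_split; try (clear -lvn lilt nlb nN NW; lia).
      by move=> E3; rewrite (introT eqP E3) in R_eq; split; [|by split|by right].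
    move=> E3; have ll := low_lt E3; rewrite (introF eqP E3) in R_eq.
    wp_split; try (clear -ll lilt nlb nN NW; lia).
    by split; [|by split|by right].
  move=> b0; rewrite (introF eqP b0) /= in R_eq.
  wp_split; try (clear -lvn lilt nlb nN NW; lia).
    by move=> E3; rewrite (introT eqP E3) in R_eq; split; [|by split|by right].
  move=> E3; have ll := low_lt E3; rewrite (introF eqP E3) in R_eq.
  wp_split; try (clear -ll lilt nlb nN NW; lia).
  by split; [|by split|by right].
- rewrite (introF eqP E) /= in R_eq.
  have lilt : r 17 < r 18.
    by rewrite ltn_neqAle lin andbT; apply/eqP => /Lr [].
  have [lvE [rest [L _ _]]] := Ll lilt; have [/andP[_ lvn] _] := lows _ lilt.
  rewrite -lvE in lvn.
  have := list_atP L; rewrite (introF eqP E) => -[rest' [_ _ aW]].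
  wp_compute; wp_split; try (clear -lvn nN NW aW cb BW; lia).
    by move=> E1; rewrite (introT eqP E1) /= in R_eq; split; [|by split|by right].
  move=> E1; rewrite (introF eqP E1) /= in R_eq; wp_split.
    by move=> E2; rewrite (introT eqP E2) /= in R_eq; split; [|by split|by right].
  move=> E2; rewrite (introF eqP E2) /= in R_eq; wp_split.
    by move=> E3; rewrite E3 in R_eq; split; [|by split|by right].
  by move=> E3; rewrite ltnNge E3 in R_eq; split; [|by split|by right].
Qed.

Lemma wp_norm s : consts s -> rg s 23 <= n -> rg s 24 < n ->
  wp w N inp emit_norm (fun s' => [/\ absD s' = absD s, absE s' = enorm (absE s),
     consts s' & rg s' 14 = rg s 14]) s.
Proof.
case: s => r f l; rewrite /consts; wp_compute => -[cN cM cI cB] en on.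
split=> E1; wp_split; try (clear -en on nN NW; lia); move=> E2; wp_split;
  try (clear -en on nN NW; lia); move=> E3; wp_split; try (clear -en on nN NW; lia);
  split=> //; rewrite /enorm /norm;
  first [rewrite (introT eqP E1) | rewrite (introF eqP E1)];
  first [rewrite (introT eqP E2) | rewrite (introF eqP E2)];
  by first [rewrite (introT eqP E3) | rewrite (introF eqP E3)].
Qed.

Lemma wp_row s : consts s -> rg s 14 = thr B (rg s 0) -> rg s 3 <= n -> rg s 15 <= B + 1 ->
  rg s 23 <= n -> rg s 24 < n ->
  wp w N inp emit_row (fun s' =>
   [/\ (absD s', absE s') = estep_row n M B (absD s) (absE s), consts s' &
      rg s' 0 = 10 \/ rg s' 14 = thr B (rg s' 0)]) s.
Proof.
case: s => r f l cs th sn cb en on; have [cN cM cI cB] := cs.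
move R_eq: (estep_row _ _ _ _ _) => R; have R0 := R_eq; rewrite /estep_row /= in R_eq.
rewrite /= in cN cM cI cB th sn cb en on.
apply: wp_ifeq => E; rewrite /= cN in E.
  rewrite (introT eqP E) in R_eq; apply: wp_ifeq => E1; rewrite /= in E1.
    have -> : R = advance n (absD (State r f l)) (absE (State r f l)).
      by rewrite -R0 /estep_row /= E E1 !eqxx.
    by apply: wp_advance; rewrite // [rg _ _]/= th E1.
  rewrite (introF eqP E1) in R_eq; wp_compute; wp_split; first by clear -cb BW; lia.
  by split; [|by split|by right].
rewrite (introF eqP E) /= -th in R_eq; apply: wp_iflt => E2; rewrite /= in E2.
  rewrite E2 in R_eq; wp_compute; wp_split; first by clear -cb BW; lia.
  by split; [|by split|by right].
rewrite ltnNge E2 /= in R_eq; wp_compute; rewrite cI.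
wp_split; try (clear -en on nN NW; lia).
  by move=> E3; rewrite (introT eqP E3) in R_eq; split; [|by split|by right].
by move=> E3; rewrite (introF eqP E3) in R_eq; split; [|by split|by right].
Qed.

Lemma wp_emit s : consts s -> rg s 14 = thr B (rg s 0) ->
  cinv w inp n M wmax B adj 1 (absD s) (absE s) -> rg s 3 <= n ->
  wp w N inp emit (emit_post s) s.
Proof.
move=> cs th I sn; apply: wp_ifeq => E; first exact: wp_low.
have [em1 [on so en _ [cb _]]] : eem (absE s) = 1 /\ row_inv n M B adj (dsrc (absD s)) (absE s).
  by have [_ _ _ _ [[em0 _]|]] := I; first case: (E em0).
apply: wp_seq; refine (wp_mono _ (wp_norm cs en on)) => s1 [D1 E1 cs1 th1].
have estepE : estep inp n M B (absD s) (absE s) = estep_row n M B (absD s1) (absE s1).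
  by rewrite /estep em1 D1 E1.
have ph1 : rg s1 0 = rg s 0 := f_equal dph D1.
have [fi fe] : efirst (absE s) (eo (absE s)) <= n /\
    efirst (absE s) (eo (absE s)) <> (eo (absE s)).+1.
  by case: I => _ H _ _ _; exact: (H _ on).
have [/andP[_ en1] _ _ _ _] := norm_spec n_ge2 en on fi fe.
have th2 : rg s1 14 = thr B (rg s1 0) by rewrite th1 ph1.
have sn1 : rg s1 3 <= n by rewrite (f_equal dsrc D1 : rg s1 3 = rg s 3).
have cb1 : rg s1 15 <= B + 1 by rewrite (f_equal ecnt E1 : rg s1 15 = rg s 15).
have e1 : rg s1 23 <= n by rewrite (f_equal ee E1 : rg s1 23 = ee (enorm (absE s))).
have o1 : rg s1 24 < n by rewrite (f_equal eo E1 : rg s1 24 = eo (enorm (absE s))).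
refine (wp_mono _ (wp_row cs1 th2 sn1 cb1 e1 o1)) => s2.
by rewrite /emit_post estepE.
Qed.
End Steps.

(** * Preprocessing and the loop invariant *)

Lemma dsrc_dstep inp n M d : dsrc (dstep inp n M d) = dsrc d.
Proof.
case: d => ph ret i src h last cv j en a D perm pos bk st /=.
by case: ph => [|[|[|[|[|[|[|[|[|[|ph]]]]]]]]]] //=; do !case: ifP.
Qed.

Section Run.
Variables (c w N : nat) (inp : nat -> nat) (n wmax : nat) (adj : nat -> seq (nat * nat)).
Local Notation W := (2 ^ w).
Local Notation total := (\sum_(v < n) size (adj v)).
(** With weights at most n^c, a walk without repeated vertices weighs less than n^(c+1), which is at
    most [2 ^ Mof]. *)
Definition Mof : nat := log2 n * (c + 1).
Definition Qof : nat := total %/ n.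
(** Four times 6 M + 3 q + 40: a run costs at most n times the latter, and only n / 4 outputs may be
    available to cover it. *)
Definition Bof : nat := Mof * 24 + Qof * 12 + 160.
Local Notation M := Mof.
Local Notation q := Qof.
Local Notation B := Bof.

Hypothesis n_gt0 : 0 < n.
Hypothesis inp0 : inp 0 = n.
Hypothesis inp_deg : forall v, v < n -> inp (v * 2 + 1) = size (adj v).
Hypothesis adj_list : forall v, v < n -> list_at w inp (inp (v * 2 + 2)) (adj v).
Hypothesis adj_bound : forall (v y wt : nat), v < n -> (y, wt) \in adj v ->
  (0 < y <= n) && (wt <= wmax).
Hypothesis adj_size : forall v, size (adj v) <= n.
Hypothesis short : forall u v k, u < n -> reach adj u v k ->
  exists2 k', reach adj u v k' & k' < 2 ^ M.
Hypotheses (nN : n + 1 <= N) (MN : M + 2 <= N) (NW : N * 2 + 2 < W).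
Hypotheses (INFW : 2 ^ M + wmax < W) (nnW : n * n + n + 4 < W).
Hypothesis (BnW : M * 24 + n * 12 + 163 < W).

Local Notation inv0 d x := (cinv w inp n M wmax B adj 0 d x).
Local Notation consts := (consts n M B).

Lemma q_le : q <= n.
Proof.
rewrite /Qof -[X in _ <= X](mulnK n n_gt0) leq_div2r //.
rewrite -[X in X * n](card_ord n) -sum_nat_const.
by apply: leq_sum => v _; apply: adj_size.
Qed.

Lemma B_lt : B + 3 < W.
Proof. by have := q_le; rewrite /Bof; clear -BnW; lia. Qed.

Lemma total_lt : total < (q + 1) * n.
Proof. by rewrite addn1 /Qof; apply: ltn_ceil. Qed.

Lemma budgetP r : n <= 4 * r -> pot_start n M adj + 2 <= B * r.
Proof.
move=> nr; pose b0 := M * 6 + q * 3 + 40.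
have -> : B * r = b0 * (4 * r) by rewrite /Bof /b0; clear; lia.
apply: leq_trans (_ : b0 * n <= _); last by rewrite leq_mul2l nr orbT.
have := total_lt; rewrite /pot_start /pot_run /b0; move: (q) (M) => a b.
move: (total) => m.
(* The part of the cost without a factor n is M + 10; it is what raises the coefficient of M from 5
   to 6. *)
have : b + 10 <= (b + 10) * n by rewrite leq_pmulr.
by clear; lia.
Qed.

(** The unit taken from [phi] becomes the slack; [estep_inv] then turns it into waiting time or
    discards it with an output. *)
Lemma cinv_dstep d x : inv0 d x -> cinv w inp n M wmax B adj 1 (dstep inp n M d) x.
Proof.
case=> lo fi f0 [phi dp bud] mode; case: (dph d =P 9) => [E|n9].
  have -> : dstep inp n M d = d by case: (d) E => ph ? ? ? ? ? ? ? ? ? ? ? ? ? ? /= ->.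
  by split=> //; exists phi => // /(_ E).
split=> //; last by rewrite dsrc_dstep.
have I : dinv w inp n M wmax adj d phi by case: dp => [//|[_ /n9]].
have [phi0 I'] := dinv_step adj_list adj_bound short I n9.
exists phi.-1; first by left.
by move=> _; have := bud n9; clear -phi0; lia.
Qed.

Lemma cinv_ph d x : inv0 d x -> 3 <= dph d <= 9 /\ dsrc d <= n.
Proof.
case=> _ _ _ [phi dp _] _; case: dp => [|[-> -> _]] //.
case: d => ph ret i src h last cv j en a D perm pos bk st [/ltnW sn I]; split=> //.
by case: ph I => [|[|[|[|[|[|[|[|[|[|]]]]]]]]]].
Qed.

Definition inv (s : state) : Prop :=
  [/\ 2 <= n, consts s, rg s 14 = thr B (rg s 0) & inv0 (absD s) (absE s)] \/
  [/\ rg s 0 = 10, rg s 15 <= B + 2 & log_ok n adj (out s) (fun _ _ => true)].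

Lemma inv_bound s : inv s -> rg s 15 <= B + 2 /\ size (out s) <= n * n.
Proof.
case=> [[n2 _ _ I]|[_ cb lo]]; first exact: (cinv_bound n2 I).
by split; last exact: log_size lo.
Qed.

Lemma inv_step s : inv s -> rg s 0 <> 10 ->
  wp w N inp (body c) (fun s' => inv s' /\
    ((out s' = out s /\ rg s' 15 = (rg s 15).+1) \/
     (exists x, out s' = rcons (out s) x /\ rg s' 15 = 0))) s.
Proof.
move=> [[n2 cs th I] _|[-> //]].
have [ph_b sn] := cinv_ph I; have BW := B_lt.
apply: wp_iflt => [lt|_]; first by have : 3 <= rg s 0 by [case/andP: ph_b]; move: lt; rewrite /opval; clear; lia.
have [_ _ _ [phi dp _] _] := I.
have dp' : dinv w inp n M wmax adj (absD s) phi \/ rg s 0 = 9.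
  by case: dp => [|[_ E _]]; [left | right].
apply: wp_seq; refine (wp_mono _ (wp_dijk nN MN NW INFW cs th dp')).
move=> s1 [D1 E1 cs1 th1].
have I1 : cinv w inp n M wmax B adj 1 (absD s1) (absE s1) by rewrite D1 E1; apply: cinv_dstep.
have sn1 : rg s1 3 <= n.
  by have -> : rg s1 3 = dsrc (absD s1) by []; rewrite D1 dsrc_dstep.
refine (wp_mono _ (wp_emit n2 nN NW BW cs1 th1 I1 sn1)).
move=> s2 [DE cs2 th2].
have := estep_inv n2 adj_list adj_bound budgetP I1; rewrite -DE => -[F em].
split; last first.
  have o1 : out s1 = out s := f_equal elog E1.
  have c1 : rg s1 15 = rg s 15 := f_equal ecnt E1.
  by rewrite -o1 -c1; exact: em.
case: F => [I2|[H1 H2 H3]]; last by right.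
by left; split=> //; case: th2 => // E; have [/andP[_]] := cinv_ph I2; rewrite /= E.
Qed.

Definition idle (s : state) : Prop :=
  [/\ [/\ rg s 3 = 0, rg s 15 = 0, rg s 16 = 0 & rg s 17 = 0],
      [/\ rg s 21 = 0, rg s 23 = 0 & rg s 24 = 0],
      forall v, fd s 7 v = 0 & out s = [::]].

(** Register 26 is the bit length of the index in register 2, increased whenever the index reaches
    the power of 2 in register 25. At index n it is [log2 n], obtained in the same pass as the sum
    of the degrees. *)
Definition sum_inv (s : state) : Prop :=
  [/\ 2 <= n, rg s 0 = 1, rg s 10 = n, idle s &
  [/\ rg s 18 = 0, rg s 2 <= n, rg s 27 = \sum_(0 <= v < rg s 2) size (adj v),
      rg s 25 = 2 ^ rg s 26 &
      rg s 2 < 2 ^ rg s 26 /\ (rg s 26 = 0 \/ 2 ^ (rg s 26).-1 <= rg s 2)]].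

(* The last inequality is Markov's: each vertex that is not listed has
   out-degree at least twice the average. *)
Definition low_pre_inv (s : state) : Prop :=
  [/\ 2 <= n, rg s 0 = 2, consts s, rg s 14 = B & idle s] /\
  [/\ rg s 28 = q * 2 + 2, 0 < rg s 2 <= n, rg s 18 < rg s 2,
      (rg s 2 - 1 - rg s 18) * (q * 2 + 2) <= \sum_(0 <= v < rg s 2) size (adj v) &
      (forall j, j < rg s 18 -> 0 < fd s 6 j < rg s 2 /\ size (adj (fd s 6 j)) < q * 2 + 2) /\
      (forall j k, j < rg s 18 -> k < rg s 18 -> fd s 6 j = fd s 6 k -> j = k)].

Definition pre (s : state) : Prop := [\/ s = state0, sum_inv s | low_pre_inv s].

Definition mu (s : state) : nat :=
  if rg s 0 == 0 then 2 * n + 3 else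
  if rg s 0 == 1 then n - rg s 2 + n + 2 else n - rg s 2 + 1.

Lemma pre_step_sum s : sum_inv s ->
  wp w N inp (pre_sum c) (fun s' => out s' = [::] /\ pre s' /\ mu s' < mu s) s.
Proof.
case: s => r f l [n2 ph cN id_ [nl iN ms pw [il lo]]].
rewrite /= in ph cN nl iN ms pw il lo.
have [[z1 z2 z3 z4] [z5 z6 z7] z8 z9] := id_; rewrite /= in z1 z2 z3 z4 z5 z6 z7 z8 z9.
have qn := q_le; have BW := B_lt.
have IW : 2 ^ M < W by apply: leq_ltn_trans (leq_addr _ _) INFW.
have MW : M + 2 < W by clear -MN NW; lia.
rewrite /pre /mu; apply: wp_ifeq => E; rewrite /= in E.
  have L1 : r 26 = log2 n.
    rewrite E cN in il lo.
    case: (r 26 =P 0) => [E0|L0]; first by rewrite E0 expn0 in il; clear -il n2; lia.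
    case: lo => // lo; rewrite -[LHS](prednK (n := r 26)) ?lt0n; last exact/eqP.
    rewrite /log2; congr S; apply/esym; apply: trunc_log_eq => //.
    by rewrite lo prednK // lt0n; apply/eqP.
  have msE : r 27 = total by rewrite ms E cN big_mkord.
  wp_compute; rewrite msE cN L1 -/Qof -/Mof.
  wp_split; rewrite ?mul1n; try (clear -MW IW BnW qn nnW; rewrite ?/Bof; lia).
  - exact: z9.
  - apply: Or33; split; first by split.
    by cbn; rewrite nl; split.
  - by rewrite ph /=; clear -n2; lia.
have iltn : r 2 < n by rewrite cN in E; clear -iN E; lia.
have ms_le : r 27 + size (adj (r 2)) <= n * n.
  rewrite ms -big_nat_recr //= big_mkord.
  apply: (@leq_trans (\sum_(v < (r 2).+1) n)).
    by apply: leq_sum => v _; apply: adj_size.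
  by rewrite sum_nat_const card_ord leq_mul2r iltn orbT.
have L_lt : r 26 < 2 ^ r 26 by apply: ltn_expl.
wp_compute; rewrite (inp_deg iltn).
have iW : r 2 * 2 + 2 < W by clear -iltn nN NW; lia.
wp_split; try (clear -iW ms_le nnW; lia).
  move=> E1; have pwi : 2 ^ r 26 <= n by rewrite -pw -E1; clear -iltn; lia.
  wp_split; try (clear -pw pwi L_lt nnW; nia).
  - exact: z9.
  - apply: Or32; split=> //; split=> //=; rewrite ?addn1.
    + exact: iltn.
    + by rewrite big_nat_recr //= ms.
    + by rewrite expnS mul2n -addnn pw.
    + rewrite -pred_Sn expnS -pw -E1; split; first by clear; lia.
      by right; rewrite addn1.
  - by rewrite ph /=; clear -iltn; lia.
move=> E1; wp_split.
- exact: z9.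
- apply: Or32; split=> //; split=> //=; rewrite ?addn1.
  + exact: iltn.
  + by rewrite big_nat_recr //= ms.
  + split; first by rewrite ltn_neqAle il andbT -pw -addn1; apply/eqP.
    by case: lo => [|lo]; [left | right; apply: leq_trans lo _].
- by rewrite ph /=; clear -iltn; lia.
Qed.

Lemma pre_step_low s : low_pre_inv s ->
  wp w N inp pre_low (fun s' => out s' = [::] /\ ((pre s' /\ mu s' < mu s) \/ inv s')) s.
Proof.
case: s => r f l [[n2 ph cs th id_] [Qd /andP[i0 iN] nl cnt [lows inj]]].
rewrite /= in ph th nl i0 iN Qd cnt lows inj.
have [cN cM cI cB] := cs; rewrite /= in cN cM cI cB.
have [[z1 z2 z3 z4] [z5 z6 z7] z8 z9] := id_; rewrite /= in z1 z2 z3 z4 z5 z6 z7 z8 z9.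
rewrite /pre /mu; apply: wp_ifeq => E; rewrite /= cN in E.
  (* With nl listed vertices the count gives 2 (n - 1 - nl) < n, so n <= 2 nl + 1. As n >= 2 this
     forces nl >= 1, and then n <= 4 nl. *)
  have nl4 : n <= 4 * r 18.
    have := leq_ltn_trans cnt; rewrite E big_mkord => /(_ _ total_lt).
    have -> : q * 2 + 2 = (q + 1) * 2 by clear; lia.
    rewrite mulnCA ltn_mul2l => /andP[_]; clear -n2; lia.
  have nl0 : 0 < r 18 by clear -nl4 n2; lia.
  have [/andP[l0 ln] ls] := lows _ nl0; rewrite E in ln.
  have lW : f 6 0 * 2 + 2 < W by clear -ln nN NW; lia.
  wp_compute; wp_split; try (clear -lW nN; lia).
    exact: z9.
  right; left; split=> //.
  split=> //=; rewrite ?z1 ?z2 ?z3 ?z4 ?z5 ?z6 ?z7.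
  - by rewrite z9; split=> // u v _ _ _; rewrite /done_pair !ltn0 z8 !andbF.
  - by move=> v vn; rewrite z8.
  - exists (pot_start n M adj).
      by left; split=> //; split=> //; rewrite /pot_start; clear; lia.
    move=> _; rewrite /avail /= z3 z4 subn0 !addn0.
    by apply: leq_trans (leq_addr 2 _) (budgetP nl4).
  - left; split=> //; split=> //; split=> //=; rewrite ?z4; split=> //.
    + by rewrite nl4 andbT; clear -nl iN; lia.
    + move=> j /lows [/andP[lj0 ljn] ls']; rewrite E in ljn; rewrite lj0 ljn; split=> //.
      by move: ls'; rewrite /Bof; clear; lia.
    + split=> //.
      * move=> _; split=> //; exists (adj (f 6 0)); split; first exact: adj_list.
          by move: ls; rewrite z2 /Bof; clear; lia.
        by rewrite z5; split.
      * by move=> E0; move: nl0; rewrite -E0.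
have iltn : r 2 < n by clear -iN E; lia.
have iW : r 2 * 2 + 2 < W by clear -iltn nN NW; lia.
have sz : \sum_(0 <= v < r 2 + 1) size (adj v) =
    \sum_(0 <= v < r 2) size (adj v) + size (adj (r 2)) by rewrite addn1 big_nat_recr.
wp_compute; rewrite (inp_deg iltn) Qd.
wp_split; try (clear -iW iltn; lia).
  move=> lt; wp_split; try (clear -iW nl iltn nN; lia).
    exact: z9.
  left; split; last by rewrite ph /=; clear -iltn; lia.
  apply: Or33; split; [by split | split=> //=].
  - by clear -iltn; lia.
  - by clear -nl; lia.
  - rewrite /= sz; have -> : r 2 + 1 - 1 - (r 18 + 1) = r 2 - 1 - r 18 by clear; lia.
    by apply: leq_trans cnt (leq_addr _ _).
  - split=> [j|j k] /=; rewrite /seta.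
      case: eqP => [->|nj] jb; first by split=> //; clear -i0; lia.
      have [|/andP[j1 j2] j3] := lows j; first by clear -jb nj; lia.
      by split=> //; rewrite j1; clear -j2; lia.
    case: eqP => [->|nj] jb; case: eqP => [->|nk] kb //.
    + by have [|/andP[_ k2] _] := lows k; [clear -kb nk | clear -k2]; lia.
    + by have [|/andP[_ k2] _] := lows j; [clear -jb nj | clear -k2]; lia.
    + by apply: inj; [clear -jb nj | clear -kb nk]; lia.
move=> ge; wp_split; try (clear -iW nl iltn nN; lia).
  exact: z9.
left; split; last by rewrite ph /=; clear -iltn; lia.
apply: Or33; split; [by split | split=> //=].
- by clear -iltn; lia.
- by clear -nl; lia.
- rewrite /= sz; have -> : r 2 + 1 - 1 - r 18 = (r 2 - 1 - r 18) + 1 by clear -nl; lia.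
  by rewrite mulnDl mul1n leq_add.
- split=> //= j /lows [/andP[j1 j2] j3]; split=> //; rewrite j1; clear -j2; lia.
Qed.

Lemma pre_step s : pre s -> rg s 0 <> 10 /\
  wp w N inp (body c) (fun s' => out s' = [::] /\ ((pre s' /\ mu s' < mu s) \/ inv s')) s.
Proof.
move=> H; split; first by case: H => [->|[_ ->]|[[_ ->]]].
case: H => [->|Hs|Hl].
- apply: wp_iflt => // _; apply: wp_ifeq => // _; wp_compute; rewrite inp0; split=> n2.
    (* For n = 1 there is no pair to output, and the empty log is already complete. *)
    split=> //; right; right; split=> //; split=> // u v un vn.
    have -> : u = v by [clear -n2 un vn; lia]; by rewrite eqxx.
  split=> //; left; split.
    apply: Or32; split=> //; split=> //=; first by rewrite big_geq.
    by split=> //; left.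
  by rewrite /mu /=; clear; lia.
- have ph : rg s 0 = 1 by case: Hs.
  apply: wp_iflt => [_|]; last by rewrite /opval ph.
  apply: wp_ifeq; first by rewrite /opval ph.
  move=> _; apply: wp_ifeq; last by rewrite /opval ph.
  move=> _; refine (wp_mono _ (pre_step_sum Hs)) => s' [o1 [p1 m1]].
  by split=> //; left.
- have ph : rg s 0 = 2 by case: Hl => -[].
  apply: wp_iflt => [_|]; last by rewrite /opval ph.
  apply: wp_ifeq; first by rewrite /opval ph.
  move=> _; apply: wp_ifeq; first by rewrite /opval ph.
  by move=> _; apply: pre_step_low.
Qed.
End Run.

(** * Graphs and the final bounds *)

Section Bridge.
Variables (n : nat) (G : wgraph n) (adj : nat -> seq (nat * nat)).
Hypothesis adjE : forall u : 'I_n,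
  perm_eq (adj u) [seq ((val v).+1, weight G u v) | v <- enum 'I_n & edge G u v].

Lemma mem_adj (u : 'I_n) (y wt : nat) :
  (y, wt) \in adj u <-> exists v : 'I_n, [/\ edge G u v, y = v.+1 & wt = weight G u v].
Proof.
rewrite (perm_mem (adjE u)); split.
  by case/mapP => v; rewrite mem_filter => /andP[e _] [-> ->]; exists v.
move=> [v [e -> ->]]; apply/mapP; exists v => //.
by rewrite mem_filter e mem_enum.
Qed.

Lemma walk_weight_rcons (u : 'I_n) p v :
  walk_weight G u (rcons p v) = walk_weight G u p + weight G (last u p) v.
Proof. by elim: p u => [|x p IH] u /=; rewrite ?addn0 // IH addnA. Qed.

Lemma reach_walk (u : 'I_n) v k : reach adj u v k ->
  exists v' : 'I_n, val v' = v /\ exists2 p, walk G u v' p & walk_weight G u p = k.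
Proof.
elim=> [|x k' y wt _ [x' [<- [p /andP[pp /eqP lp] <-]]] /mem_adj [z [e [->] ->]]].
  by exists u; split=> //; exists [::] => //; apply/andP.
exists z; split=> //; exists (rcons p z).
  by rewrite /walk rcons_path last_rcons pp lp e eqxx.
by rewrite walk_weight_rcons lp.
Qed.

Lemma walk_reach (u v : 'I_n) p : walk G u v p -> reach adj u v (walk_weight G u p).
Proof.
elim/last_ind: p v => [|p x IH] v; rewrite /walk.
  by move=> /andP[_ /eqP <-]; apply: reach0.
rewrite rcons_path last_rcons => /andP[/andP[pp e] /eqP <-].
rewrite walk_weight_rcons; apply: reachS (IH (last u p) _) _.
  by rewrite /walk pp eqxx.
by apply/mem_adj; exists x.
Qed.

Lemma isD_dist (u v : 'I_n) d : isD adj u v d <-> is_dist G u v d.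
Proof.
case: d => [k|] /=; split.
- case=> /reach_walk [v' [/val_inj -> R]] H; split=> // p /walk_reach; apply: H.
- case=> -[p wp <-] H; split; first exact: walk_reach.
  by move=> k' /reach_walk [v' [/val_inj -> [q wq <-]]]; apply: H.
- by move=> H p; apply/negP => /walk_reach /H.
- by move=> H k /reach_walk [v' [/val_inj -> [q wq _]]]; have := H q; rewrite wq.
Qed.

Lemma is_dist_inj (u v : 'I_n) d d' : is_dist G u v d -> is_dist G u v d' -> d = d'.
Proof.
case: d d' => [k|] [k'|] //=.
- move=> [[p wp pk] H] [[p' wp' pk'] H']; congr Some; apply/eqP.
  by rewrite eqn_leq; apply/andP; split; [rewrite -pk'; exact: H | rewrite -pk; exact: H'].
- by move=> [[p wp _] _] H; have := H p; rewrite wp.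
- by move=> H [[p wp _] _]; have := H p; rewrite wp.
Qed.

Lemma log_ok_APSD log : log_ok n adj log (fun _ _ => true) -> no_self_APSD G log.
Proof.
move=> [l1 l2 l3]; split; first exact: map_uniq l1.
move=> x; split.
  move=> /l2 [u [v [d [un vn uv -> D]]]].
  exists (Ordinal un), (Ordinal vn), d; split=> //.
  by apply/isD_dist.
move=> [u [v [d [uv D ->]]]].
have := l3 u v (ltn_ord u) (ltn_ord v) uv; move/mapP => [y ylog yE].
have [u' [v' [d' [un vn uv' E D']]]] := l2 _ ylog.
rewrite E in yE ylog; case: yE => uE vE; subst u' v'.
have E2 := is_dist_inj D (proj1 (isD_dist u v d') D').
by rewrite E2.
Qed.

(** Removing cycles leaves at most n - 1 arcs, and [0 < b] makes the bound strict. *)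
Lemma short_walk b : weights_le G b -> 0 < b ->
  forall u v k, u < n -> reach adj u v k -> exists2 k', reach adj u v k' & k' < n * b.
Proof.
move=> wb b0 u v k un; rewrite -[u]/(val (Ordinal un)).
move=> /reach_walk [v' [<- [p /andP[pp /eqP lp] _]]].
move: lp; case: (shortenP pp) => p' pp' up' _ lp.
exists (walk_weight G (Ordinal un) p').
  by apply: walk_reach; rewrite /walk pp' lp eqxx.
have sz : size p' < n.
  by have := max_card [in Ordinal un :: p']; rewrite card_ord (card_uniqP up').
apply: leq_ltn_trans (_ : size p' * b < _); last by rewrite ltn_mul2r b0.
elim: p' (Ordinal un) pp' {up' sz lp} => [|x p' IH] y //= /andP[e pp'].
by rewrite mulSn leq_add ?IH // wb.
Qed.
End Bridge.

(** * Word size and final constants *)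

Lemma static_body c w : c + 200 < 2 ^ w -> static_ok w (body c).
Proof.
by move=> H; rewrite /=; do ![apply/andP; split] => //; lia.
Qed.

Lemma log2_gt n : n < 2 ^ log2 n.
Proof. exact: trunc_log_ltn. Qed.

Lemma log2_le n : 0 < n -> log2 n <= n.
Proof.
move=> n0; have /andP[le _] := trunc_log_bounds (isT : 1 < 2) n0.
exact: leq_trans (ltn_expl _ (isT : 1 < 2)) le.
Qed.

(** With lam = 2^(log2 n), every quantity depending on n or c is at most T = lam^(c+2). The word
    size leaves a further factor lam^18, and lam >= 2 even for n = 1, so the numerical factors are
    absorbed. *)
Lemma word_bound c n w : 0 < n -> (c + 20) * log2 n <= w ->
  [/\ 8 * ((c + 3) * n) + 8 < 2 ^ w, 2 ^ Mof c n + n ^ c < 2 ^ w,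
      n * n + n + 4 < 2 ^ w, Mof c n * 24 + n * 12 + 163 < 2 ^ w & c + 200 < 2 ^ w].
Proof.
move=> n0 hw; set lam := 2 ^ log2 n; pose T := lam ^ c * lam * lam.
have nl : n < lam := log2_gt n.
have ll : log2 n <= lam by apply: leq_trans (log2_le n0) (ltnW nl).
have l2 : 2 <= lam by rewrite /lam /log2 expnS leq_pmulr // expn_gt0.
have cP : c + 1 <= lam ^ c by rewrite addn1; apply: leq_trans (ltn_expl c (isT : 1 < 2)) _; case: (c) => // k; rewrite leq_exp2r.
have nc : n ^ c <= lam ^ c by case: (c) => // k; rewrite leq_exp2r // ltnW.
have ME : 2 ^ Mof c n = lam ^ c * lam by rewrite /Mof expnM addn1 expnSr.
have TW : T * 2 ^ 18 <= 2 ^ w.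
  apply: leq_trans (_ : 2 ^ ((c + 20) * log2 n) <= _); last by rewrite leq_exp2l.
  have -> : 2 ^ ((c + 20) * log2 n) = lam ^ c * (lam ^ 2 * lam ^ 18).
    by rewrite mulnC expnM -/lam -!expnD.
  by rewrite mulnA -mulnn mulnA leq_mul // leq_exp2r.
have T1 : 0 < T by rewrite /T !muln_gt0 expn_gt0 (ltnW l2).
have Wb : T * 1000 < 2 ^ w.
  apply: leq_trans TW; rewrite ltn_mul2l T1 /=.
  exact: (leq_trans (isT : 1000 < 2 ^ 10) (leq_pexp2l _ _)).
have P1 : 0 < lam ^ c by rewrite expn_gt0 (ltnW l2).
have TE : T = lam ^ c * (lam * lam) by rewrite /T mulnA.
have llT : lam * lam <= T by rewrite TE leq_pmull.
have lT : lam <= T by apply: leq_trans llT; rewrite leq_pmull // ltnW.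
have PlT : lam ^ c * lam <= T by rewrite /T leq_pmulr // ltnW.
have PT : lam ^ c <= T by apply: leq_trans PlT; rewrite leq_pmulr // ltnW.
have nnT : n * n <= T by apply: leq_trans llT; apply: leq_mul; apply: ltnW.
have cnT : (c + 1) * n <= T by apply: leq_trans PlT; apply: leq_mul => //; apply: ltnW.
have MT : Mof c n <= T by apply: leq_trans PlT; rewrite /Mof mulnC leq_mul.
have nT : n <= T := leq_trans (ltnW nl) lT.
have cT : c + 1 <= T := leq_trans cP PT.
have ncT : n ^ c <= T := leq_trans nc PT.
rewrite ME; move: (lam ^ c * lam) PlT (n * n) nnT (n ^ c) ncT (Mof c n) MT => a Ha b Hb d Hd e He.
have -> : (c + 3) * n = (c + 1) * n + 2 * n by rewrite -mulnDl -addnA.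
move: ((c + 1) * n) cnT => g Hg.
by clear -Wb T1 Ha Hb Hd He Hg cT nT; split; lia.
Qed.

Lemma delay_bound n tot q l C x : 0 < n -> q * n <= tot -> x <= C * (q + l) ->
  (x%:R <= C%:R * (tot%:R / n%:R + l%:R) :> rat)%R.
Proof.
move=> n0 qn; rewrite -(Num.Theory.ler_nat rat) => /Order.POrderTheory.le_trans; apply.
rewrite GRing.natrM Num.Theory.ler_wpM2l ?Num.Theory.ler0n // GRing.natrD.
rewrite Num.Theory.lerD2r Num.Theory.ler_pdivlMr ?Num.Theory.ltr0n //.
by rewrite -GRing.natrM Num.Theory.ler_nat.
Qed.

Theorem theorem12 (c : nat) :
  exists (P : program) (kappa Cpre Cdelay Clow Cup : nat),
  forall (n : nat) (G : wgraph n) (w : nat) (inp : nat -> nat),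
    0 < n -> weights_le G (n ^ c) ->
    kappa * log2 n <= w -> encodes w inp G ->
    exists T : nat,
      [/\ halts_after w inp P T,
          no_self_APSD G (outputs w inp P T),
          exists2 p : nat, p <= Cpre * n &
            delay_le w inp P T p
              (Cdelay%:R * (avg_outdeg G + (log2 n)%:R))%R &
          n <= Clow * space_used w inp P T /\ space_used w inp P T <= Cup * n].
Proof.
(* Hiding the value of [K] keeps the compiled code from being unfolded in the arithmetic below. *)
have [K KE] : exists K, K = size (compile (body c) 13) + 3 by eexists.
(* Preprocessing ends by time 11 + K (2 n + 4), which is at most (11 + 6 K) n as n >= 1. The waiting
   time is at most K (B + 4); there [log2 n >= 1] absorbs the additive constant. *)
exists (loop_prog (body c)), (c + 20), (11 + K * 6), (K * (24 * c + 200)), 1, (8 * (c + 3) + 8).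
move=> n G w inp n0 wle hw [inp_lt inp0 inp_deg lists].
have [f fperm flist] := fin_all_exists2 lists.
pose adj (v : nat) : seq (nat * nat) := odflt [::] (omap f (insub v)).
have adjf (u : 'I_n) : adj u = f u by rewrite /adj valK.
have adjE (u : 'I_n) : perm_eq (adj u)
    [seq ((val v).+1, weight G u v) | v <- enum 'I_n & edge G u v].
  by rewrite adjf.
have adj_deg (u : 'I_n) : size (adj u) = outdeg G u.
  by rewrite (perm_size (adjE u)) size_map size_filter -sum1_count big_enum_cond /=
    /outdeg -sum1_card; apply: eq_bigl.
have deg v : v < n -> inp (v * 2 + 1) = size (adj v).
  by move=> vn; rewrite -[v]/(val (Ordinal vn)) adj_deg -inp_deg muln2 addn1.
have adj_list v : v < n -> list_at w inp (inp (v * 2 + 2)) (adj v).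
  by move=> vn; rewrite -[v]/(val (Ordinal vn)) adjf muln2 addn2; apply: flist.
have adj_bound (v y wt : nat) : v < n -> (y, wt) \in adj v ->
    (0 < y <= n) && (wt <= n ^ c).
  move=> vn; rewrite -[v]/(val (Ordinal vn)) => /(mem_adj adjE) [z [e -> ->]].
  by rewrite ltn_ord /= wle.
have adj_size v : size (adj v) <= n.
  case: (ltnP v n) => [vn|nv]; last by rewrite /adj insubF // ltnNge nv.
  by rewrite -[v]/(val (Ordinal vn)) adj_deg -[X in _ <= X]card_ord max_card.
have [h1 h2 h3 h4 h5] := word_bound n0 hw.
have l_le := log2_le n0.
have nc_gt0 : 0 < n ^ c by rewrite expn_gt0 n0.
have short u v k : u < n -> reach adj u v k ->
    exists2 k', reach adj u v k' & k' < 2 ^ Mof c n.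
  move=> un /(short_walk adjE wle nc_gt0 un) [k' R lt]; exists k' => //.
  apply: leq_trans lt _; rewrite -expnS /Mof addn1 expnM.
  by rewrite leq_exp2r //; apply/ltnW/log2_gt.
(* Arrays are indexed by vertices and by the bucket numbers up to M + 1; the factor c + 3 makes room
   for both because [log2 n <= n]. *)
set N := (c + 3) * n in h1.
have nN : n + 1 <= N by rewrite /N; clear -n0; nia.
have MN : Mof c n + 2 <= N by rewrite /N /Mof; clear -n0 l_le; nia.
have NW : N * 2 + 2 < 2 ^ w by clear -h1; lia.
have W16 : 16 <= 2 ^ w by clear -h5; lia.
have nN' : n <= N by clear -nN; lia.
have [T [halt [sf [If H10 outE]] [p pb pth] sp]] :=
  loop_correct h1 W16 inp0 nN' (static_body h5)
    (fun s => inv_bound (c := c) (w := w) (inp := inp) (wmax := n ^ c) (s := s))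
    (inv_step n0 adj_list adj_bound adj_size short nN MN NW h2 h4)
    (conj (Or31 _ _ (erefl state0) : pre c n adj state0) (leqnn _))
    (pre_step n0 inp0 deg adj_list adj_size nN MN NW h2 h3 h4).
rewrite -KE in pb pth.
have slow x : x <= K * (Bof c n adj + 2 + 2) ->
    (x%:R <= (K * (24 * c + 200))%N%:R * (avg_outdeg G + (log2 n)%:R) :> rat)%R.
  move=> le; have leB : Bof c n adj + 2 + 2 <= (24 * c + 200) * (Qof n adj + log2 n).
    rewrite /Bof /Mof; have : 0 < log2 n by []; move: (log2 n) (Qof n adj) => a b.
    by clear; nia.
  apply: (delay_bound (q := Qof n adj) n0).
    by apply: leq_trans (leq_trunc_div _ _) _; apply: leq_sum => v _; rewrite adj_deg.
  by apply: leq_trans le _; rewrite -mulnA leq_mul.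
exists T; split=> //.
- rewrite outE; apply: (log_ok_APSD adjE).
  case: If => [[n2 _ _ I]|[_ _ lo]] //.
  by have [/andP[_]] := cinv_ph I; rewrite /= H10.
- exists p.
    apply: leq_trans pb _; have -> : mu n state0 = 2 * n + 3 by [].
    by rewrite mulnDl -mulnA leq_add ?leq_pmulr // leq_mul2l; clear -n0; lia.
  by apply: sub_path pth => t t' /andP[tt le]; rewrite tt; apply: slow.
- case/andP: sp => s1 s2; split; first by rewrite mul1n ltnW.
  by apply: leq_trans s2 _; rewrite /N; clear -n0; nia.
Qed.
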